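(* Let $\phi:A(\mathbb{T})\times A(\mathbb{T})\to\mathbb{C}$ be a continuous bilinear map satisfying, for some $\alpha\geq 0$, $$f,g\in A(\mathbb{T}),\ \operatorname{supp} f\cap\operatorname{supp} g=\emptyset\ \Longrightarrow\ |\phi(f,g)|\leq\alpha\|f\|\|g\|.$$ Then $$|\phi(fg,h)-\phi(f,gh)|\leq 288\pi(1+\sqrt{2})\,\alpha\,\|f\|\|g\|\|h\|$$ for all $f,g,h\in A(\mathbb{T})$.
   Context: $\mathbb{T}$ is the unit circle, identified with $[-\pi,\pi]$ modulo $2\pi$. For $f\in L^1(\mathbb{T})$, $\hat f(n)=\frac{1}{2\pi}\int_{-\pi}^{\pi}f(t)e^{-int}\,dt$ ($n\in\mathbb{Z}$). The Fourier algebra is $A(\mathbb{T})=\{f\in L^1(\mathbb{T}):\|f\|=\sum_{n\in\mathbb{Z}}|\hat f(n)|<\infty\}$, a Banach algebra of continuous functions under pointwise operations; $\|\cdot\|$ denotes this norm. $\operatorname{supp} f$ is the closure of $\{s\in\mathbb{T}: f(s)\neq 0\}$. *)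

(* Defs.v *)
From mathcomp Require Import all_boot all_order all_algebra.
From mathcomp Require Import complex.
From mathcomp Require Import all_classical all_reals all_analysis.
Import Order.TTheory GRing.Theory Num.Theory.
Import numFieldNormedType.Exports.

Set Implicit Arguments.
Unset Strict Implicit.
Unset Printing Implicit Defensive.

Local Open Scope classical_set_scope.
Local Open Scope ring_scope.
Local Open Scope complex_scope.

(* The real-valued modulus on R[i]; the generic norm `|z| takes its values   *)
(* in R[i] itself.                                                            *)
Notation normc := ComplexField.Normc.normc.

(* Functions on the circle T = [-pi, pi] modulo 2pi are encoded as            *)
(* 2pi-periodic functions R -> R[i].                                          *)
Section FourierAlgebra.
Context {R : realType}.
Implicit Types (f g : R -> R[i]) (phi : (R -> R[i]) -> (R -> R[i]) -> R[i]).

Local Notation mu := (@lebesgue_measure R).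

Definition expi (x : R) : R[i] := cos x +i* sin x.

Definition cintegral (D : set R) f : R[i] :=
  (\int[mu]_(t in D) complex.Re (f t)) +i* (\int[mu]_(t in D) complex.Im (f t)).

Definition L1_circle : set (R -> R[i]) :=
  [set f | [/\ periodic f (pi *+ 2),
               mu.-integrable `[- pi, pi] (fun t => (complex.Re (f t))%:E) &
               mu.-integrable `[- pi, pi] (fun t => (complex.Im (f t))%:E)]].

Definition fourier_coef f (n : int) : R[i] :=
  ((pi *+ 2)^-1)%:C *
  cintegral `[- pi, pi] (fun t => f t * expi (- (n%:~R * t))).

Definition fourier_enorm f : \bar R :=
  \esum_(n in [set: int]) (normc (fourier_coef f n))%:E.

(* A class in L^1(T) whose Fourier series converges absolutely has exactly    *)
(* one continuous representative; the elements of A(T) are these              *)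
(* representatives, so that pointwise values and supports make sense. The     *)
(* cast to R[i]^o only gives R[i] its usual topology.                         *)
Definition fourier_algebra : set (R -> R[i]) :=
  [set f | [/\ L1_circle f, continuous (f : R -> R[i]^o) & (fourier_enorm f < +oo)%E]].

(* Meaningful on fourier_algebra only: fine sends +oo to 0.                   *)
Definition fourier_norm f : R := fine (fourier_enorm f).

(* The closure is taken in R; for periodic f it is the preimage of the        *)
(* closure taken in T, so disjointness of supports means the same in both.    *)
Definition supp f : set R := closure [set s | f s != 0].

(* A map on A(T) x A(T) is encoded as a total map on functions of which only  *)
(* the values at elements of fourier_algebra matter.                          *)
Definition bilinear_on_fourier_algebra phi : Prop :=
  (forall (a : R[i]) f1 f2 g,
     fourier_algebra f1 -> fourier_algebra f2 -> fourier_algebra g ->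
     phi (a \*o f1 \+ f2) g = a * phi f1 g + phi f2 g) /\
  (forall (a : R[i]) f g1 g2,
     fourier_algebra f -> fourier_algebra g1 -> fourier_algebra g2 ->
     phi f (a \*o g1 \+ g2) = a * phi f g1 + phi f g2).

Definition continuous_on_fourier_algebra phi : Prop :=
  forall f0 g0, fourier_algebra f0 -> fourier_algebra g0 ->
  forall e : R, 0 < e -> exists2 d : R, 0 < d &
    forall f g, fourier_algebra f -> fourier_algebra g ->
      fourier_norm (f \- f0) < d -> fourier_norm (g \- g0) < d ->
      normc (phi f g - phi f0 g0) < e.

End FourierAlgebra.

(* Main.v *)
Require Import Defs.
From mathcomp Require Import all_boot all_order all_algebra.
From mathcomp Require Import complex.
From mathcomp Require Import all_classical all_reals all_analysis.
From mathcomp Require Import ring lra zify.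
Import Order.TTheory GRing.Theory Num.Theory.
Import numFieldNormedType.Exports.

(** Every f in A(T) is the absolutely convergent sum of its Fourier series
    (uniqueness of Fourier coefficients for continuous functions, then
    [fourier_inversion]), so A(T) is l^1(Z) with convolution.  Both sides of the
    inequality are bounded and linear in each of f, g, h, and a bounded linear
    functional on l^1 is controlled by its values on the characters
    ([linear_bound_of_chr]).  It thus suffices to bound
      phi (chr (j + k)) (chr l) - phi (chr j) (chr (l + k))
    by a multiple of alpha, uniformly in j, k, l.

    Put b_m = phi (chr (j + mk)) (chr (l + k - mk)), a bounded sequence running along
    an antidiagonal.  The difference to be bounded is b_1 - b_0, and second
    differences are enough: if |b_2 - 2 b_1 + b_0| <= S for all base points and
    steps, then the supremum D of the first differences over all of them satisfies
    2D <= D + S, because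
      2 (b_1 - b_0) = (b_2 - b_0) - (b_2 - 2 b_1 + b_0);
    as D is finite, D <= S ([shift_bound_chr]).

    Second differences are bounded by testing phi on translates.  Let w be the
    truncated cosine max (cos t - 1/10, 0) and w_m its Fourier coefficients.  The
    functions w (Nt - x) and w (Nt - x - pi) have disjoint supports for every x, so
    phi of this pair is at most alpha |w|^2.  Averaging over x keeps only the
    antidiagonal terms, and gives
      | sum_m (- 1)^m w_m^2 phi (chr (Nm)) (chr (- Nm)) | <= alpha |w|^2
    ([normc_diag_sum]).  Replacing phi by
      psi (f, g) = phi (chr j f, chr l g) - phi (chr j, chr l) (fg)^(0),
    which satisfies the same hypothesis because fg = 0 when the supports are
    disjoint, removes the term m = 0; what remains is a combination of second
    differences with weights w_m^2, m >= 1.  Explicit integrals give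
    w_1^2 > sum_(m >= 2) w_m^2, so the supremum S of all second differences can be
    absorbed: c S <= c' S + C alpha with c' < c ([second_diff_bound]).  Again the
    continuity of phi enters only through the finiteness of S.  The constant
    obtained, 152, is smaller than 288 pi (1 + sqrt 2). *)

Set Implicit Arguments.
Unset Strict Implicit.
Unset Printing Implicit Defensive.

Local Open Scope classical_set_scope.
Local Open Scope ring_scope.

(** * Complex numbers and characters *)

Section Complex.
Context {R : realType}.
Local Notation Re := complex.Re.
Local Notation Im := complex.Im.
Local Notation "x %:C" := (real_complex_def (Phant R) x) : ring_scope.
Implicit Types (z w : R[i]) (f g : R -> R[i]).

Lemma normrE z : `|z| = (normc z)%:C. Proof. by case: z. Qed.

Lemma normc_ge0 z : 0 <= normc z. Proof. by case: z => a b; exact: sqrtr_ge0. Qed.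

Lemma normcD z w : normc (z + w) <= normc z + normc w.
Proof. exact: le_normcD. Qed.

Lemma normcZ (a : R) z : normc (a%:C * z) = `|a| * normc z.
Proof.
rewrite ComplexField.Normc.normcM; congr (_ * _).
by rewrite /= expr0n /= addr0 sqrtr_sqr.
Qed.

Lemma normc_real (a : R) : normc a%:C = `|a|.
Proof. by rewrite /= expr0n /= addr0 sqrtr_sqr. Qed.

Lemma normcB z w : normc (z - w) = normc (w - z).
Proof. by rewrite -normcN opprB. Qed.

Lemma normc_sum (I : Type) (s : seq I) (P : pred I) (F : I -> R[i]) :
  normc (\sum_(i <- s | P i) F i) <= \sum_(i <- s | P i) normc (F i).
Proof.
elim/big_rec2: _ => [|i a z _ h]; first by rewrite ComplexField.Normc.normc0.
by apply: (le_trans (normcD _ _)); rewrite lerD2l.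
Qed.

Lemma ler_Re z : `|Re z| <= normc z.
Proof. by case: z => a b /=; rewrite -sqrtr_sqr ler_wsqrtr// lerDl sqr_ge0. Qed.

Lemma ler_Im z : `|Im z| <= normc z.
Proof. by case: z => a b /=; rewrite -sqrtr_sqr ler_wsqrtr// lerDr sqr_ge0. Qed.

Lemma normc_le_ReIm z : normc z <= `|Re z| + `|Im z|.
Proof.
case: z => a b /=; rewrite -[leRHS]ger0_norm ?addr_ge0// -sqrtr_sqr ler_wsqrtr//.
rewrite sqrrD !real_normK ?num_real// addrAC lerDl.
by rewrite mulrn_wge0 ?mulr_ge0.
Qed.

Lemma cReD z w : Re (z + w) = Re z + Re w. Proof. by case: z; case: w. Qed.
Lemma cImD z w : Im (z + w) = Im z + Im w. Proof. by case: z; case: w. Qed.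
Lemma cReB z w : Re (z - w) = Re z - Re w. Proof. by case: z; case: w. Qed.
Lemma cImB z w : Im (z - w) = Im z - Im w. Proof. by case: z; case: w. Qed.
Lemma cReM z w :
  Re (z * w) = Re z * Re w - Im z * Im w. Proof. by case: z; case: w. Qed.
Lemma cImM z w :
  Im (z * w) = Re z * Im w + Im z * Re w. Proof. by case: z; case: w. Qed.

Lemma complex_ext z w : Re z = Re w -> Im z = Im w -> z = w.
Proof. by case: z; case: w => a b c d /= -> ->. Qed.

(** Wrapped in a record, so that proof search never unfolds the underlying filter
    inclusions when comparing two functions. *)
Record ccont f : Prop := CCont { ccont_cvg : continuous (f : R -> R[i]^o) }.

Lemma ccontP f : ccont f <->
  forall t (e : R), 0 < e -> \forall s \near t, normc (f t - f s) < e.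
Proof.
split=> [cf t e e0|cf]; last split=> t.
  case: cf => /(_ t) /cvgrPdist_lt/(_ e%:C).
  rewrite ltcR => /(_ e0); apply: filterS => s.
  by rewrite normrE ltcR.
apply/cvgrPdist_lt => e; case: e => a b; rewrite ltcE /= => /andP[/eqP -> a0].
have := cf t a a0; apply: filterS => s.
by rewrite normrE ltcR.
Qed.

Lemma ccont_Re {f} : ccont f -> continuous (fun t => Re (f t)).
Proof.
move=> /ccontP cf t; apply/cvgrPdist_lt => e e0.
by have := cf t e e0; apply: filterS => s; apply: le_lt_trans; rewrite -cReB ler_Re.
Qed.

Lemma ccont_Im {f} : ccont f -> continuous (fun t => Im (f t)).
Proof.
move=> /ccontP cf t; apply/cvgrPdist_lt => e e0.
by have := cf t e e0; apply: filterS => s; apply: le_lt_trans; rewrite -cImB ler_Im.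
Qed.

Lemma ccont_ReIm f : continuous (fun t => Re (f t)) ->
  continuous (fun t => Im (f t)) -> ccont f.
Proof.
move=> cr ci; apply/ccontP => t e e0.
have e2 : 0 < e / 2 by rewrite divr_gt0.
have /cvgrPdist_lt/(_ _ e2) hr := cr t.
have /cvgrPdist_lt/(_ _ e2) hi := ci t.
near=> s.
apply: (le_lt_trans (normc_le_ReIm _)); rewrite (splitr e) cReB cImB.
by apply: ltrD; near: s.
Unshelve. all: by end_near. Qed.

Lemma ccontD f g : ccont f -> ccont g -> ccont (f \+ g).
Proof. by move=> [cf] [cg]; split=> t; exact: (cvgD (cf t) (cg t)). Qed.

Lemma ccontM f g : ccont f -> ccont g -> ccont (f \* g).
Proof. by move=> [cf] [cg]; split=> t; exact: (cvgM (cf t) (cg t)). Qed.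

Lemma ccont_cst z : ccont (fun=> z).
Proof. by split=> t; exact: cvg_cst. Qed.

Lemma expiD x y : expi (x + y) = expi x * expi y :> R[i].
Proof.
apply: complex_ext; rewrite ?cReM ?cImM /= ?cosD ?sinD; ring.
Qed.

Lemma expi0 : expi 0 = 1 :> R[i]. Proof. by rewrite /expi cos0 sin0. Qed.

Lemma expiK x : expi x * expi (- x) = 1 :> R[i].
Proof. by rewrite -expiD subrr expi0. Qed.

Lemma normc_expi x : normc (expi x : R[i]) = 1.
Proof. by rewrite /= cos2Dsin2 sqrtr1. Qed.

Lemma expi_pi : expi pi = - 1 :> R[i].
Proof. by rewrite /expi cospi sinpi; apply: complex_ext => /=; rewrite ?oppr0. Qed.

Lemma expi_2pi : expi (pi *+ 2) = 1 :> R[i].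
Proof. by rewrite mulr2n expiD expi_pi mulrNN mulr1. Qed.

Lemma expi_nat x (n : nat) : expi (n%:R * x) = expi x ^+ n :> R[i].
Proof.
elim: n => [|n IH]; first by rewrite mul0r expi0 expr0.
by rewrite -addn1 natrD mulrDl mul1r expiD IH exprD expr1.
Qed.

Definition chr (n : int) (t : R) : R[i] := expi (n%:~R * t).

Lemma chrD m n t : chr (m + n) t = chr m t * chr n t.
Proof. by rewrite /chr rmorphD mulrDl expiD. Qed.

Lemma chr0 t : chr 0 t = 1. Proof. by rewrite /chr mul0r expi0. Qed.

Lemma normc_chr n t : normc (chr n t) = 1. Proof. exact: normc_expi. Qed.

Lemma chr_2pi n : chr n (pi *+ 2) = 1.
Proof.
have nat m : expi (m%:R * (pi *+ 2)) = 1 :> R[i].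
  by rewrite expi_nat expi_2pi expr1n.
case: n => n; rewrite /chr; first by rewrite -pmulrn nat.
have := expiK (n.+1%:R * (pi *+ 2)); rewrite nat mul1r -mulNr.
by rewrite NegzE rmorphN.
Qed.

Lemma periodic_chr n : periodic (chr n) (pi *+ 2).
Proof.
by move=> t; rewrite /chr mulrDr expiD -/(chr n (pi *+ 2)) chr_2pi mulr1.
Qed.

Lemma ccont_chr n : ccont (chr n).
Proof.
apply: ccont_ReIm => t /=; apply: continuous_comp.
- exact: mulrl_continuous.
- exact: continuous_cos.
- exact: mulrl_continuous.
- exact: continuous_sin.
Qed.

End Complex.

(** * Integrals and Fourier coefficients *)

Section Coefficients.
Context {R : realType}.
Local Notation mu := (@lebesgue_measure R).
Local Notation Re := complex.Re.
Local Notation Im := complex.Im.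
Local Notation "x %:C" := (real_complex_def (Phant R) x) : ring_scope.
Implicit Types (z w : R[i]) (f g : R -> R[i]).

Lemma continuous_integrable (h : R -> R) (a b : R) : continuous h ->
  mu.-integrable `[a, b] (EFin \o h).
Proof.
move=> ch; apply: continuous_compact_integrable; first exact: segment_compact.
exact: continuous_subspaceT.
Qed.

Lemma Rintegral_FTC2 (F h : R -> R) (a b : R) : a < b -> continuous h ->
  (forall x : R, is_derive x (1 : R) F (h x)) ->
  \int[mu]_(x in `[a, b]) h x = F b - F a.
Proof.
move=> ab ch dF; rewrite /Rintegral (@continuous_FTC2 R h F)//.
- exact: continuous_subspaceT.
- have cF : continuous F.
    by move=> x; apply/differentiable_continuous/derivable1_diffP; case: (dF x).
  split => [x _||]; first by case: (dF x).
  - exact/cvg_at_right_filter/cF.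
  - exact/cvg_at_left_filter/cF.
- by move=> x _; rewrite derive1E; exact: derive_val.
Qed.

Lemma cintegralD f g (a b : R) : ccont f -> ccont g ->
  cintegral `[a, b] (f \+ g) = cintegral `[a, b] f + cintegral `[a, b] g.
Proof.
move=> cf cg; apply: complex_ext; rewrite /= ?cReD ?cImD /=.
- under eq_Rintegral do rewrite cReD.
  by apply: RintegralD => //; apply: continuous_integrable; exact: ccont_Re.
- under eq_Rintegral do rewrite cImD.
  by apply: RintegralD => //; apply: continuous_integrable; exact: ccont_Im.
Qed.

Lemma cintegralZ z f (a b : R) : ccont f ->
  cintegral `[a, b] (z \*o f) = z * cintegral `[a, b] f.
Proof.
move=> cf; have ir : mu.-integrable `[a, b] (EFin \o (fun t => Re (f t))).
  exact/continuous_integrable/ccont_Re.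
have ii : mu.-integrable `[a, b] (EFin \o (fun t => Im (f t))).
  exact/continuous_integrable/ccont_Im.
have iZ (c : R) h : mu.-integrable `[a, b] (EFin \o h) ->
    mu.-integrable `[a, b] (EFin \o (fun t => c * h t)).
  by move=> ih; exact: (integrableZl _ c ih).
apply: complex_ext; rewrite ?cReM ?cImM /=.
- under eq_Rintegral do rewrite /= cReM.
  by rewrite RintegralB ?RintegralZl//; exact: iZ.
- under eq_Rintegral do rewrite /= cImM.
  by rewrite RintegralD ?RintegralZl//; exact: iZ.
Qed.

Lemma normr_Rintegral_le (h : R -> R) (a b B : R) : a <= b -> continuous h ->
  (forall t, `|h t| <= B) -> `|\int[mu]_(t in `[a, b]) h t| <= B * (b - a).
Proof.
move=> ab ch hB; have ih := continuous_integrable a b ch.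
apply: (le_trans (le_normr_Rintegral _ ih)) => //.
have -> : B * (b - a) = \int[mu]_(t in `[a, b]) B.
  rewrite Rintegral_cst//=; congr (_ * _).
  by rewrite lebesgue_measure_itv/= lte_fin; case: ltgtP ab => //= -> _; rewrite subrr.
apply: le_Rintegral => //.
  by apply: continuous_integrable => t; apply: cvg_norm; exact: ch.
by apply: continuous_integrable => t; exact: cvg_cst.
Qed.

Lemma fourier_coefE f n : fourier_coef f n =
  ((pi *+ 2)^-1)%:C * cintegral `[- pi, pi] (f \* chr (- n)).
Proof.
rewrite /fourier_coef; congr (_ * cintegral _ _); apply/funext => t /=.
by rewrite /chr rmorphN mulNr.
Qed.

Lemma fourier_coefD f g n : ccont f -> ccont g ->
  fourier_coef (f \+ g) n = fourier_coef f n + fourier_coef g n.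
Proof.
move=> cf cg; rewrite !fourier_coefE -mulrDr.
have -> : (f \+ g) \* chr (- n) = f \* chr (- n) \+ g \* chr (- n).
  by apply/funext => t /=; rewrite mulrDl.
rewrite cintegralD//.
- by apply: ccontM => //; exact: ccont_chr.
- by apply: ccontM => //; exact: ccont_chr.
Qed.

Lemma fourier_coefZ z f n : ccont f ->
  fourier_coef (z \*o f) n = z * fourier_coef f n.
Proof.
move=> cf; rewrite !fourier_coefE mulrCA.
have -> : (z \*o f) \* chr (- n) = z \*o (f \* chr (- n)).
  by apply/funext => t /=; rewrite mulrA.
rewrite cintegralZ//.
by apply: ccontM => //; exact: ccont_chr.
Qed.

(** The factor 2 comes from bounding the real and imaginary parts separately; only
    the linear dependence on the sup bound matters below. *)
Lemma normc_fourier_coef_le f n B : ccont f -> (forall t, normc (f t) <= B) ->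
  normc (fourier_coef f n) <= 2 * B.
Proof.
move=> cf fB; rewrite fourier_coefE normcZ.
have p0 : 0 < (pi *+ 2 : R) by rewrite mulrn_wgt0// pi_gt0.
rewrite gtr0_norm ?invr_gt0// ler_pdivrMl//.
have cfn : ccont (f \* chr (- n)) by apply: ccontM => //; exact: ccont_chr.
have fnB t : normc ((f \* chr (- n)) t) <= B.
  by rewrite /= ComplexField.Normc.normcM normc_chr mulr1.
apply: (le_trans (normc_le_ReIm _)) => /=.
have ab : - pi <= pi :> R by rewrite ge0_cp ?pi_ge0.
have hr : `|\int[mu]_(t in `[- pi, pi]) Re ((f \* chr (- n)) t)| <= B * (pi - - pi).
  apply: normr_Rintegral_le ab (ccont_Re cfn) _ => t.
  exact: le_trans (ler_Re _) (fnB t).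
have hi : `|\int[mu]_(t in `[- pi, pi]) Im ((f \* chr (- n)) t)| <= B * (pi - - pi).
  apply: normr_Rintegral_le ab (ccont_Im cfn) _ => t.
  exact: le_trans (ler_Im _) (fnB t).
apply: (le_trans (lerD hr hi)); lra.
Qed.

Lemma cintegral_chr n : n != 0 -> cintegral `[- pi, pi] (chr n) = 0 :> R[i].
Proof.
move=> n0; have nz : n%:~R != 0 :> R by rewrite intr_eq0.
have ab : - pi < pi :> R by rewrite gt0_cp ?pi_gt0.
have sz : sin (n%:~R * pi) = 0 :> R.
  have := congr1 (@complex.Re R) (chr_2pi n) => /=.
  rewrite mulrnAr cos_mulr2n => h.
  have : cos (n%:~R * pi) ^+ 2 = 1 :> R by lra.
  by move=> h'; apply/eqP; rewrite -sqrf_eq0 sin2cos2 h' subrr.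
apply: complex_ext => /=.
- have dS (x : R) : is_derive x (1 : R) (fun t : R => n%:~R^-1 * sin (n%:~R * t))
      (cos (n%:~R * x)).
    by apply: is_derive_eq; rewrite /GRing.scale /=; field.
  rewrite (Rintegral_FTC2 ab _ dS); last exact: (ccont_Re (ccont_chr n)).
  by rewrite mulrN sinN sz; ring.
- have dC (x : R) : is_derive x (1 : R) (fun t : R => - (n%:~R^-1 * cos (n%:~R * t)))
      (sin (n%:~R * x)).
    by apply: is_derive_eq; rewrite /GRing.scale /=; field.
  rewrite (Rintegral_FTC2 ab _ dC); last exact: (ccont_Im (ccont_chr n)).
  by rewrite mulrN cosN; ring.
Qed.

Lemma fourier_coef_chr k n : fourier_coef (chr k : R -> R[i]) n = (n == k)%:R.
Proof.
rewrite fourier_coefE.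
have -> : chr k \* chr (- n) = chr (k - n) :> (R -> R[i]).
  by apply/funext => t /=; rewrite chrD.
have [->|nk] := eqVneq n k; last first.
  by rewrite cintegral_chr ?mulr0// subr_eq0 eq_sym.
have p0 : pi *+ 2 != 0 :> R by rewrite mulrn_eq0 /= gt_eqF ?pi_gt0.
have -> : cintegral `[- pi, pi] (chr (k - k)) = (pi *+ 2 : R)%:C.
  rewrite subrr; apply: complex_ext => /=.
  - under eq_Rintegral do rewrite mul0r cos0.
    rewrite Rintegral_cst//= lebesgue_measure_itv/= lte_fin gt0_cp ?pi_gt0//=; ring.
  - under eq_Rintegral do rewrite mul0r sin0.
    by rewrite Rintegral_cst// mul0r.
by rewrite -rmorphM mulVf.
Qed.

End Coefficients.

(** * Integrating against powers of a shifted cosine *)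

Section Kernels.
Context {R : realType}.
Local Notation mu := (@lebesgue_measure R).
Local Notation "x %:C" := (real_complex_def (Phant R) x) : ring_scope.
Implicit Types (z w : R[i]) (f g : R -> R[i]).

Lemma Rintegral_sub (h : R -> R) (a b c d : R) : c <= a -> b <= d ->
  \int[mu]_(t in `[a, b]) h t = \int[mu]_(t in `[c, d]) (h \_ `[a, b]) t.
Proof.
move=> ca bd; rewrite -Rintegral_mkcondr; congr Rintegral.
apply/seteqP; split=> t /=; rewrite !in_itv /=; last by case.
by move=> /andP[h1 h2]; split; rewrite ?h1 ?h2// (le_trans ca h1) (le_trans h2 bd).
Qed.

Lemma Rintegral_ge_sub (h : R -> R) (a b c d B : R) : continuous h ->
  (forall t, 0 <= h t) -> a <= b -> c <= a -> b <= d ->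
  (forall t, a <= t <= b -> B <= h t) ->
  B * (b - a) <= \int[mu]_(t in `[c, d]) h t.
Proof.
move=> ch h0 ab ca bd hB.
have ih x y : mu.-integrable `[x, y] (EFin \o h) by exact: continuous_integrable.
apply: (@le_trans _ _ (\int[mu]_(t in `[a, b]) h t)).
  have -> : B * (b - a) = \int[mu]_(t in `[a, b]) B.
    rewrite Rintegral_cst//=; congr (_ * _).
    by rewrite lebesgue_measure_itv/= lte_fin; case: ltgtP ab => //= -> _; rewrite subrr.
  apply: le_Rintegral => //.
    by apply: continuous_integrable => t; exact: cvg_cst.
rewrite (Rintegral_sub h ca bd); apply: le_Rintegral => //.
- rewrite -restrict_EFin; apply/integrable_restrict => //=.
  suff -> : [set` `[c, d]] `&` [set` `[a, b]] = [set` `[a, b]] :> set R by exact: ih.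
  by apply/setIidPr => t /=; rewrite !in_itv /=; lra.
- by move=> t _; rewrite patchE; case: ifP.
Qed.

Lemma fourier_coef_chrM m f n :
  fourier_coef (chr m \* f) n = fourier_coef f (n - m).
Proof.
rewrite !fourier_coefE; congr (_ * cintegral _ _); apply/funext => t /=.
by rewrite opprB chrD; ring.
Qed.

(** A shifted cosine is a combination of two characters, so multiplication by it
    preserves the vanishing of all Fourier coefficients. *)
Lemma cos_chr (t x : R) :
  (cos (t - x))%:C = 2^-1 * expi (- x) * chr 1 t + 2^-1 * expi x * chr (- 1) t.
Proof.
have h2 : (2 : R[i])^-1 = (2^-1)%:C by rewrite rmorphV ?unitfE ?pnatr_eq0// rmorph_nat.
rewrite h2 /chr !mulN1r mul1r cosB; apply: complex_ext;
  rewrite ?(cReD, cImD, cReM, cImM) /= ?(cReM, cImM) /= ?cosN ?sinN; by field.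
Qed.

Lemma fourier_coef0_cosX f x c k n : ccont f ->
  (forall n, fourier_coef f n = 0) ->
  fourier_coef (fun t => f t * ((cos (t - x) + c) ^+ k)%:C) n = 0.
Proof.
move=> cf f0.
have cq1 : ccont (fun t => (cos (t - x) + c)%:C).
  apply: ccont_ReIm => t /=; last exact: cvg_cst.
  apply: cvgD; last exact: cvg_cst.
  apply: (@cvg_comp _ _ _ (fun t => t - x) cos); last exact: continuous_cos.
  by apply: cvgB => //; exact: cvg_cst.
have cq j : ccont (fun t => f t * ((cos (t - x) + c) ^+ j)%:C).
  apply: (@ccontM _ f) => //; elim: j => [|j IH].
    by under eq_fun do rewrite expr0; exact: ccont_cst.
  have -> : (fun t => ((cos (t - x) + c) ^+ j.+1)%:C) =
    (fun t => (cos (t - x) + c)%:C) \* (fun t => ((cos (t - x) + c) ^+ j)%:C).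
    by apply/funext => t /=; rewrite exprS rmorphM.
  exact: ccontM.
elim: k n => [|k IH] n.
  rewrite -(f0 n); congr (fourier_coef _ n); apply/funext => t.
  by rewrite expr0 mulr1.
set g := fun t => f t * ((cos (t - x) + c) ^+ k)%:C in IH.
have cg : ccont g := cq k.
have -> : (fun t => f t * ((cos (t - x) + c) ^+ k.+1)%:C) =
    c%:C \*o g \+ ((2^-1 * expi (- x)) \*o (chr 1 \* g) \+
                   (2^-1 * expi x) \*o (chr (- 1) \* g)).
  apply/funext => t /=; rewrite /g exprS rmorphM rmorphD /= cos_chr; ring.
have cc m : ccont (chr m \* g) by apply: ccontM => //; exact: ccont_chr.
rewrite !fourier_coefD ?fourier_coefZ ?fourier_coef_chrM ?IH ?mulr0 ?addr0//;
  by do ?[apply: ccontD]; do ?[exact: ccontM (ccont_cst _) _].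
Qed.

End Kernels.

(** * Uniqueness of Fourier coefficients *)

Section Uniqueness.
Context {R : realType}.
Local Notation mu := (@lebesgue_measure R).
Local Notation Re := complex.Re.
Implicit Types (z w : R[i]) (f g : R -> R[i]).

Lemma ge_cos_near (d u : R) : 0 <= d <= pi -> `|u| <= d -> cos d <= cos u.
Proof.
move=> /andP[d0 dp] ud; rewrite -(cos_norm u) leNgt ltr_cos ?in_itv /= ?d0 ?normr_ge0//.
  by rewrite -leNgt.
exact: le_trans ud dp.
Qed.

Lemma le_cos_far (d u : R) : 0 <= d <= pi -> d <= `|u| <= pi *+ 2 - d -> cos u <= cos d.
Proof.
move=> /andP[d0 dp] /andP[du ud]; rewrite -(cos_norm u).
have [up|pu] := leP `|u| pi.
  by rewrite leNgt ltr_cos ?in_itv /= ?d0 ?dp ?normr_ge0// -leNgt.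
have -> : cos `|u| = cos (pi *+ 2 - `|u|).
  by rewrite -(cosN `|u|) -(cosD2pi (- `|u|)) addrC.
apply: ge_cos_near; last by rewrite ger0_norm; lra.
lra.
Qed.

Lemma bernoulli_le (s : R) k : 0 <= s -> 1 + k%:R * s <= (1 + s) ^+ k.
Proof.
move=> s0; elim: k => [|k IH]; first by rewrite mul0r addr0 expr0.
rewrite exprS -natr1; apply: (@le_trans _ _ ((1 + s) * (1 + k%:R * s))).
  have : 0 <= s * (k%:R * s) by rewrite !mulr_ge0.
  lra.
by rewrite ler_pM2l// ltr_pwDl.
Qed.

(** The classical peak argument.  The function q = 1 + cos (t - x) - cos d exceeds 1
    near x and satisfies |q| <= 1 away from x.  All integrals of Re f against powers
    of q vanish, whereas a positive value of Re f at x would make them tend to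
    infinity; by Bernoulli's inequality they grow at least linearly in the
    exponent. *)
Lemma Re_le0_of_fourier_coef0 f x : ccont f ->
  (forall n, fourier_coef f n = 0) -> - pi < x < pi -> Re (f x) <= 0.
Proof.
move=> cf f0 /andP[xl xr]; rewrite leNgt; apply/negP => fx0.
pose H t := Re (f t).
have cH : continuous H := ccont_Re cf.
pose c := H x / 2.
have c0 : 0 < c by rewrite divr_gt0.
(* The bounds by x + pi and pi - x keep the peak inside the interval, and so
   |t - x| <= 2 pi - d on all of it. *)
have [d [d0 d1 dl dr dH]] : exists d, [/\ 0 < d, d <= 1, - pi <= x - d, x + d <= pi &
    forall t, `|t - x| <= d -> c <= H t].
  have /cvgrPdist_lt/(_ c c0) := cH x.
  move=> /nbhs_ballP[e /= e0 He].
  set m := Num.min (e / 2) 1; set m' := Num.min (x + pi) (pi - x).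
  exists (Num.min m m').
  have [m1 m2] : Num.min m m' <= m /\ Num.min m m' <= m'.
    by split; rewrite ge_min lexx ?orbT.
  move: m1 m2; rewrite !le_min => /andP[m1 m2] /andP[m3 m4]; split.
  - rewrite !lt_min; apply/andP; split; apply/andP; split; lra.
  - exact: m2.
  - lra.
  - lra.
  - move=> t tx; have := He t.
    rewrite /ball /= distrC => /(_ _).
    have te : `|t - x| < e by lra.
    move=> /(_ te); rewrite ltr_norml /c; lra.
have pi1 : 1 < pi :> R by have := @pi_ge2 R; lra.
pose q t := cos (t - x) + (1 - cos d).
pose p t := Num.max (cos (t - x) - cos d) 0.
have int0 k : \int[mu]_(t in `[- pi, pi]) (H t * q t ^+ k) = 0.
  have := fourier_coef0_cosX x (1 - cos d) k 0 cf f0.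
  rewrite fourier_coefE => /eqP; rewrite mulf_eq0.
  move=> /orP[|/eqP/(congr1 (@complex.Re R))/= <-].
    move=> /eqP/(congr1 (@complex.Re R))/= /eqP; rewrite invr_eq0 mulrn_eq0 /=.
    by rewrite gt_eqF ?pi_gt0.
  apply: eq_Rintegral => t _; rewrite oppr0 chr0 mulr1 cReM /= mulr0 subr0.
  by [].
have ccos : continuous (fun t => cos (t - x)).
  move=> t; apply: (@cvg_comp _ _ _ (fun t => t - x) cos); last exact: continuous_cos.
  by apply: cvgB => //; exact: cvg_cst.
have cp : continuous p.
  move=> t; apply: (@continuous_max R R (fun t => cos (t - x) - cos d) (cst 0)).
    by apply: cvgB; [exact: ccos|exact: cvg_cst].
  exact: cvg_cst.
have cq k : continuous (fun t => q t ^+ k).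
  elim: k => [|k IH] t; first exact: cvg_cst.
  under eq_fun do rewrite exprS.
  apply: cvgM; last exact: IH.
  by apply: cvgD; [exact: ccos|exact: cvg_cst].
have [M M0 HM] : exists2 M, 0 <= M & forall t, t \in `[- pi, pi] -> `|H t| <= M.
  have ab : - pi <= pi :> R by lra.
  have cN : {within `[(- pi), pi], continuous (fun t => `|H t|)}.
    by apply: continuous_subspaceT => t; apply: cvg_norm; exact: cH.
  have [t0 _ ht0] := EVT_max ab cN.
  by exists `|H t0|.
pose B := (cos (d / 2) - cos d) * d.
have B0 : 0 < B.
  rewrite mulr_gt0// subr_gt0 ltr_cos ?in_itv /=; lra.
have intp : B <= \int[mu]_(t in `[- pi, pi]) p t.
  have -> : B = (cos (d / 2) - cos d) * ((x + d / 2) - (x - d / 2)) by rewrite /B; lra.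
  apply: Rintegral_ge_sub => //; try lra.
  - by move=> t; rewrite le_max lexx orbT.
  - move=> t tx; rewrite le_max; apply/orP; left; rewrite lerD2r ge_cos_near//; first lra.
    rewrite ler_norml; lra.
(* p is the positive part of q - 1. *)
have key k t : t \in `[- pi, pi] -> c * k%:R * p t - M <= H t * q t ^+ k.
  move=> tI; have hM := HM t tI; move: tI; rewrite in_itv /= => /andP[tl tr].
  have [tx|tx] := leP `|t - x| d.
    have s0 : 0 <= cos (t - x) - cos d by rewrite subr_ge0 ge_cos_near//; lra.
    have -> : p t = cos (t - x) - cos d by rewrite /p max_l.
    have hc := dH t tx.
    have hb := bernoulli_le k s0.
    have -> : q t = 1 + (cos (t - x) - cos d) by rewrite /q; ring.
    apply: (@le_trans _ _ (c * (1 + (cos (t - x) - cos d)) ^+ k)); last first.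
      by rewrite ler_wpM2r// exprn_ge0// addr_ge0.
    apply: (@le_trans _ _ (c * (1 + k%:R * (cos (t - x) - cos d)))); last first.
      by rewrite ler_pM2l.
    lra.
  have s0 : cos (t - x) <= cos d.
    apply: le_cos_far; first lra.
    rewrite (ltW tx) /= ler_norml; lra.
  have -> : p t = 0 by rewrite /p max_r// subr_le0.
  have q1 : `|q t ^+ k| <= 1.
    rewrite normrX exprn_ile1// /q ler_norml.
    have := @cos_geN1 R (t - x); have := @cos_le1 R d; lra.
  have : `|H t * q t ^+ k| <= M * 1 by rewrite normrM ler_pM.
  rewrite ler_norml; lra.
have cK k : continuous (fun t => c * k%:R * p t).
  by move=> t; apply: cvgM; [exact: cvg_cst|exact: cp].
have fin k : c * k%:R * B <= M * (pi *+ 2).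
  have : \int[mu]_(t in `[- pi, pi]) (c * k%:R * p t - M) <= 0.
    rewrite -(int0 k); apply: le_Rintegral => //.
    - apply: continuous_integrable => t; apply: cvgB; last exact: cvg_cst.
      exact: cK.
    - apply: continuous_integrable => t; apply: cvgM; first exact: cH.
      exact: cq.
    - by move=> t /= tI; apply: key.
  rewrite RintegralB//; try exact: continuous_integrable; last first.
    by apply: continuous_integrable => t; exact: cvg_cst.
  rewrite RintegralZl//; last exact: continuous_integrable.
  rewrite Rintegral_cst//= lebesgue_measure_itv/= lte_fin gt0_cp ?pi_gt0//= opprK -mulr2n.
  rewrite subr_le0; apply: le_trans; rewrite ler_wpM2l// mulr_ge0//; lra.
have cB : 0 < c * B by rewrite mulr_gt0.
have : 0 <= M * (pi *+ 2) / (c * B).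
  by apply: divr_ge0; [apply: mulr_ge0 => //; lra|exact: ltW].
move=> /archi_boundP; rewrite ltr_pdivrMr//; set k := Num.Def.archi_bound _.
have := fin k; lra.
Qed.

Lemma fourier_coef0_eq0 f : ccont f -> periodic f (pi *+ 2) ->
  (forall n, fourier_coef f n = 0) -> forall t, f t = 0.
Proof.
move=> cf pf f0.
have f0oo x : - pi < x < pi -> f x = 0.
  move=> xI.
  have le0 z : Re (z * f x) <= 0.
    apply: (@Re_le0_of_fourier_coef0 (z \*o f)) => //.
      by apply: ccontM => //; exact: ccont_cst.
    by move=> n; rewrite fourier_coefZ// f0 mulr0.
  have := (le0 1, le0 (- 1), le0 ('i)%C, le0 (- 'i)%C).
  rewrite mul1r !mulNr mul1r; case: (f x) => a b /= [[[h1 h2] h3] h4].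
  by apply: complex_ext => /=; lra.
have p0 : 0 < pi :> R := pi_gt0 R.
have f0cc x : - pi <= x <= pi -> f x = 0.
  move=> xI; apply: ComplexField.Normc.eq0_normc; apply/eqP.
  rewrite eq_le normc_ge0 andbT leNgt; apply/negP => fx0.
  have /ccontP/(_ x _ fx0)/nbhs_ballP[e /= e0 He] := cf.
  pose d := Num.min (e / 2) (pi / 2).
  have [de dp d0] : [/\ d <= e / 2, d <= pi / 2 & 0 < d].
    by split; rewrite ?ge_min ?lexx ?orbT// lt_min !divr_gt0.
  (* A point within e of x, moved towards 0 to lie inside the open interval. *)
  pose y := if 0 <= x then x - d else x + d.
  have yI : - pi < y < pi by rewrite /y; case: (leP 0 x); lra.
  have : ball x e y.
    rewrite /ball /= /y; case: (leP 0 x) => _; rewrite ltr_norml; lra.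
  by move=> /He; rewrite (f0oo _ yI) subr0 ltxx.
move=> t.
pose k := Num.floor ((t + pi) / (pi *+ 2)).
have hk : f t = f (t - k%:~R * (pi *+ 2)).
  have fk (j : nat) x : f (x + j%:R * (pi *+ 2)) = f x.
    by rewrite mulr_natl; exact: periodicn.
  case: k => j; last first.
    by rewrite NegzE rmorphN mulNr opprK fk.
  by rewrite -(fk j (t - _)) subrK.
rewrite hk; apply: f0cc.
have p2 : 0 < pi *+ 2 :> R by rewrite mulrn_wgt0.
have := floor_itv ((t + pi) / (pi *+ 2)).
rewrite -/k rmorphD /= ler_pdivlMr// ltr_pdivrMr// => /andP[h1 h2].
apply/andP; split; lra.
Qed.

End Uniqueness.

(** * The Fourier norm, partial sums and completeness *)

Section FourierNorm.
Context {R : realType}.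
Implicit Types (z w : R[i]) (f g : R -> R[i]).

(* So that /= neither turns moduli into square roots nor coefficients into
   integrals. *)
#[global] Arguments ComplexField.Normc.normc : simpl never.
#[global] Arguments fourier_coef : simpl never.

(** The order 0, -1, 1, -2, 2, ... makes the partial sums of odd length symmetric
    about 0. *)
Definition zenum (k : nat) : int := if odd k then Negz k./2 else Posz k./2.

Definition zindex (n : int) : nat :=
  match n with Posz j => j.*2 | Negz j => j.*2.+1 end.

Lemma zindexK : cancel zindex zenum.
Proof. by case=> j; rewrite /zenum /= ?odd_double ?uphalf_double ?doubleK. Qed.

Lemma zenumK : cancel zenum zindex.
Proof. by move=> k; rewrite /zenum; have := odd_double_half k; case: odd. Qed.

Lemma fourier_enormE f : fourier_enorm f =
  (\sum_(k <oo) (normc (fourier_coef f (zenum k)))%:E)%E.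
Proof.
rewrite nneseries_esumT; last by move=> k; rewrite lee_fin normc_ge0.
rewrite /fourier_enorm (@reindex_esum R nat int setT setT zenum)//.
split=> //; first by move=> ? ? _ _; exact: (can_inj zenumK).
by move=> n _; exists (zindex n) => //; rewrite zindexK.
Qed.

Definition norm_psum f K := \sum_(k < K) normc (fourier_coef f (zenum k)).

Lemma fourier_algebraP f : fourier_algebra f <->
  [/\ periodic f (pi *+ 2), ccont f & (fourier_enorm f < +oo)%E].
Proof.
split; first by case=> -[pf _ _] cf ef; split=> //; split.
case=> pf cf ef; split=> //; last by case: cf.
split=> //.
- exact: (continuous_integrable _ _ (ccont_Re cf)).
- exact: (continuous_integrable _ _ (ccont_Im cf)).
Qed.

Lemma fourier_algebra_ccont f : fourier_algebra f -> ccont f.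
Proof. by case/fourier_algebraP. Qed.

Lemma fourier_norm_ge0 f : 0 <= fourier_norm f.
Proof.
rewrite /fourier_norm fine_ge0// fourier_enormE nneseries_ge0// => k _.
by rewrite lee_fin normc_ge0.
Qed.

Lemma norm_psum_le f K : fourier_algebra f -> norm_psum f K <= fourier_norm f.
Proof.
move=> /fourier_algebraP[_ _ ef].
have e0 : (0 <= fourier_enorm f)%E.
  by rewrite fourier_enormE nneseries_ge0// => k _; rewrite lee_fin normc_ge0.
rewrite -lee_fin /fourier_norm fineK; last by rewrite ge0_fin_numE.
rewrite fourier_enormE /norm_psum -sumEFin.
rewrite -(big_mkord xpredT (fun k => (normc (fourier_coef f (zenum k)))%:E)).
by apply: nneseries_lim_ge => k _; rewrite lee_fin normc_ge0.
Qed.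

(** Membership in A(T) and norm bounds are only ever established through this
    criterion on real partial sums. *)
Lemma fourier_algebra_of_norm_psum f B : periodic f (pi *+ 2) -> ccont f ->
  (forall K, norm_psum f K <= B) -> fourier_algebra f /\ fourier_norm f <= B.
Proof.
move=> pf cf fB.
have eB : (fourier_enorm f <= B%:E)%E.
  rewrite fourier_enormE; apply: lime_le.
    by apply: is_cvg_nneseries => k _; rewrite lee_fin normc_ge0.
  by apply: nearW => K; rewrite sumEFin lee_fin big_mkord; exact: fB.
have eoo := le_lt_trans eB (ltry B).
split; first by apply/fourier_algebraP.
have e0 : (0 <= fourier_enorm f)%E.
  by rewrite fourier_enormE nneseries_ge0// => k _; rewrite lee_fin normc_ge0.
by rewrite -lee_fin /fourier_norm fineK// ge0_fin_numE.
Qed.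

(** Otherwise all partial sums would stay below the norm minus e, which would then
    bound the norm. *)
Lemma norm_psum_tail f e : fourier_algebra f -> 0 < e ->
  exists K, fourier_norm f - e < norm_psum f K.
Proof.
move=> Af e0; apply: contrapT => /forallNP h.
have [pf cf _] := (fourier_algebraP f).1 Af.
have hB K : norm_psum f K <= fourier_norm f - e by rewrite leNgt; apply/negP; exact: h.
by have [_] := fourier_algebra_of_norm_psum pf cf hB; lra.
Qed.

Lemma norm_psum_homo f K L : (K <= L)%N -> norm_psum f K <= norm_psum f L.
Proof.
move=> KL; rewrite /norm_psum -(subnKC KL) big_split_ord /= lerDl sumr_ge0// => i _.
exact: normc_ge0.
Qed.

Lemma periodicD f g : periodic f (pi *+ 2) -> periodic g (pi *+ 2) ->
  periodic (f \+ g) (pi *+ 2).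
Proof. by move=> pf pg t; rewrite /= pf pg. Qed.

Lemma fourier_algebra_lin a f g : fourier_algebra f -> fourier_algebra g ->
  fourier_algebra (a \*o f \+ g) /\
  fourier_norm (a \*o f \+ g) <= normc a * fourier_norm f + fourier_norm g.
Proof.
move=> Af Ag; have [pf cf _] := (fourier_algebraP f).1 Af.
have [pg cg _] := (fourier_algebraP g).1 Ag.
have caf : ccont (a \*o f) := ccontM (ccont_cst a) cf.
apply: fourier_algebra_of_norm_psum.
- by apply: periodicD => // t /=; rewrite pf.
- exact: ccontD.
- move=> K; apply: (@le_trans _ _ (normc a * norm_psum f K + norm_psum g K)).
    rewrite /norm_psum mulr_sumr -big_split; apply: ler_sum => k _.
    rewrite fourier_coefD// fourier_coefZ// -ComplexField.Normc.normcM.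
    exact: normcD.
  by rewrite lerD ?ler_wpM2l ?normc_ge0 ?norm_psum_le.
Qed.

Lemma fourier_algebra0 : fourier_algebra (fun=> 0 : R[i]) /\
  fourier_norm (fun=> 0 : R[i]) <= 0.
Proof.
apply: fourier_algebra_of_norm_psum => //; first exact: ccont_cst.
move=> K; rewrite /norm_psum big1// => k _.
have -> : (fun=> 0) = 0 \*o (fun=> 0) :> (R -> R[i]).
    by apply/funext => t /=; rewrite mul0r.
by rewrite fourier_coefZ ?mul0r ?ComplexField.Normc.normc0//; exact: ccont_cst.
Qed.

Lemma fourier_algebraZ a f : fourier_algebra f ->
  fourier_algebra (a \*o f) /\ fourier_norm (a \*o f) <= normc a * fourier_norm f.
Proof.
move=> Af; have [A0 n0] := fourier_algebra0.
have [] := fourier_algebra_lin a Af A0.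
have -> : a \*o f \+ (fun=> 0) = a \*o f by apply/funext => t /=; rewrite addr0.
by move=> h1 h2; split; [exact: h1|apply: le_trans h2 _; rewrite gerDl].
Qed.

Lemma fourier_algebraD f g : fourier_algebra f -> fourier_algebra g ->
  fourier_algebra (f \+ g) /\ fourier_norm (f \+ g) <= fourier_norm f + fourier_norm g.
Proof.
move=> Af Ag; have [] := fourier_algebra_lin 1 Af Ag.
have -> : 1 \*o f \+ g = f \+ g by apply/funext => t /=; rewrite mul1r.
by rewrite ComplexField.Normc.normc1 mul1r.
Qed.

Lemma fourier_algebraB f g : fourier_algebra f -> fourier_algebra g ->
  fourier_algebra (f \- g).
Proof.
move=> Af Ag; have [+ _] := fourier_algebra_lin (- 1) Ag Af.
by congr fourier_algebra; apply/funext => t /=; rewrite mulN1r addrC.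
Qed.

Lemma fourier_algebra_chr n : fourier_algebra (chr n : R -> R[i]) /\
  fourier_norm (chr n : R -> R[i]) <= 1.
Proof.
apply: fourier_algebra_of_norm_psum; [exact: periodic_chr|exact: ccont_chr|].
move=> K; have coef0 k : k != zindex n ->
    normc (fourier_coef (chr n) (zenum k) : R[i]) = 0.
  move=> kn; rewrite fourier_coef_chr (_ : _ == n = false) ?ComplexField.Normc.normc0//.
  by apply: contra_neqF kn => /eqP <-; rewrite zenumK.
rewrite /norm_psum; have [nK|Kn] := ltnP (zindex n) K; last first.
  by rewrite big1// => k _; rewrite coef0// neq_ltn (leq_trans (ltn_ord k) Kn).
rewrite (bigD1 (Ordinal nK))//= big1 ?addr0 => [|k kn].
  by rewrite fourier_coef_chr zindexK eqxx ComplexField.Normc.normc1.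
by rewrite coef0.
Qed.

Definition fsum (u : nat -> R -> R[i]) K t := \sum_(k < K) u k t.

Lemma fsumS u K : fsum u K.+1 = fsum u K \+ u K.
Proof. by apply/funext => t; rewrite /fsum big_ord_recr. Qed.

Lemma fsum0 u : fsum u 0 = fun=> 0.
Proof. by apply/funext => t; rewrite /fsum big_ord0. Qed.

Lemma fourier_algebra_fsum u K : (forall k, fourier_algebra (u k)) ->
  fourier_algebra (fsum u K) /\
  fourier_norm (fsum u K) <= \sum_(k < K) fourier_norm (u k).
Proof.
move=> Au; elim: K => [|K [IH1 IH2]].
  by rewrite fsum0 big_ord0; exact: fourier_algebra0.
rewrite fsumS big_ord_recr /=; have [h1 h2] := fourier_algebraD IH1 (Au K).
by split=> //; apply: le_trans h2 _; rewrite lerD2r.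
Qed.

Lemma fourier_coef_fsum u K n : (forall k, ccont (u k)) ->
  ccont (fsum u K) /\ fourier_coef (fsum u K) n = \sum_(k < K) fourier_coef (u k) n.
Proof.
move=> cu; elim: K => [|K [IH1 IH2]].
  rewrite fsum0 big_ord0; split; first exact: ccont_cst.
  have -> : (fun=> 0) = 0 \*o (fun=> 0) :> (R -> R[i]).
    by apply/funext => t /=; rewrite mul0r.
  by rewrite fourier_coefZ ?mul0r//; exact: ccont_cst.
rewrite fsumS big_ord_recr /=; split; first exact: ccontD.
by rewrite fourier_coefD// IH2.
Qed.

Definition unif_cvg (u : nat -> R -> R[i]) F := forall e : R, 0 < e ->
  exists K0, forall K, (K0 <= K)%N -> forall t, normc (F t - fsum u K t) <= e.

Lemma normc_le_all_eq0 (z : R[i]) : (forall e : R, 0 < e -> normc z <= e) -> z = 0.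
Proof.
move=> h; apply: ComplexField.Normc.eq0_normc; apply/eqP.
by rewrite eq_le normc_ge0 andbT; apply/ler_addgt0Pr => e e0; rewrite add0r h.
Qed.

Lemma unif_cvg_ccont u F : (forall k, ccont (u k)) -> unif_cvg u F -> ccont F.
Proof.
move=> cu uF; apply/ccontP => t e e0.
have e4 : 0 < e / 4 by rewrite divr_gt0.
have [K hK] := uF _ e4; have {}hK := hK K (leqnn K).
have [/ccontP/(_ t _ e4) h _] := fourier_coef_fsum K 0 cu.
apply: filterS h => s hs.
have -> : F t - F s = (F t - fsum u K t) + ((fsum u K t - fsum u K s) - (F s - fsum u K s)).
  by ring.
apply: (le_lt_trans (normcD _ _)).
have := normcD (fsum u K t - fsum u K s) (- (F s - fsum u K s)).
rewrite normcN; have := hK t; have := hK s; lra.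
Qed.

Lemma unif_cvg_coef (u : nat -> R -> R[i]) F n :
  (forall k, ccont (u k)) -> unif_cvg u F ->
  forall e : R, 0 < e -> exists K0, forall K, (K0 <= K)%N ->
  normc (fourier_coef F n - \sum_(k < K) fourier_coef (u k) n) <= e.
Proof.
move=> cu uF e e0; have cF := unif_cvg_ccont cu uF.
have e2 : 0 < e / 2 by rewrite divr_gt0.
have [K0 hK0] := uF _ e2; exists K0 => K /hK0 hK.
have [cs <-] := fourier_coef_fsum K n cu.
have -> : fourier_coef F n - fourier_coef (fsum u K) n =
    fourier_coef (F \+ (- 1) \*o fsum u K) n.
  have cs' : ccont ((- 1) \*o fsum u K) := ccontM (ccont_cst _) cs.
  by rewrite fourier_coefD// fourier_coefZ// mulN1r.
have -> : e = 2 * (e / 2) by lra.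
apply: normc_fourier_coef_le => [|t /=]; last by rewrite mulN1r.
exact: ccontD cF (ccontM (ccont_cst _) cs).
Qed.

(** Completeness of A(T) for absolutely convergent series whose uniform sum is
    already known.  For a fixed number L of Fourier coefficients, those of F are as
    close as desired to those of a finite sum, and the L coefficients of a finite sum
    are controlled by the sum of the norms. *)
Lemma fourier_algebra_complete (u : nat -> R -> R[i]) F B :
  (forall k, fourier_algebra (u k)) ->
  (forall K, \sum_(k < K) fourier_norm (u k) <= B) -> unif_cvg u F ->
  fourier_algebra F /\ fourier_norm F <= B.
Proof.
move=> Au uB uF.
have cu k : ccont (u k) := fourier_algebra_ccont (Au k).
have cF := unif_cvg_ccont cu uF.
apply: fourier_algebra_of_norm_psum => //.
  move=> t; apply/eqP; rewrite -subr_eq0; apply/eqP; apply: normc_le_all_eq0 => e e0.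
  have e2 : 0 < e / 2 by rewrite divr_gt0.
  have [K hK] := uF _ e2; have {}hK := hK K (leqnn K).
  have [As _] := fourier_algebra_fsum K Au.
  have [ps _ _] := (fourier_algebraP _).1 As.
  have -> : F (t + pi *+ 2) - F t =
    (F (t + pi *+ 2) - fsum u K (t + pi *+ 2)) - (F t - fsum u K t).
    by rewrite ps; ring.
  apply: (le_trans (normcD _ _)); rewrite normcN.
  have := hK t; have := hK (t + pi *+ 2); lra.
move=> L; apply/ler_addgt0Pr => e e0.
have eL : 0 < e / (2 * L.+1%:R) by rewrite divr_gt0// mulr_gt0.
have [K hK] := uF _ eL; have {}hK := hK K (leqnn K).
have [As nAs] := fourier_algebra_fsum K Au.
have cs := fourier_algebra_ccont As.
have hc n : normc (fourier_coef F n) <= normc (fourier_coef (fsum u K) n) + e / L.+1%:R.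
  have -> : fourier_coef F n = fourier_coef (fsum u K) n +
      fourier_coef (F \+ (- 1) \*o fsum u K) n.
    have cs' : ccont ((- 1) \*o fsum u K) := ccontM (ccont_cst _) cs.
    by rewrite fourier_coefD// fourier_coefZ// mulN1r addrC subrK.
  apply: (le_trans (normcD _ _)); rewrite lerD2l.
  have -> : e / L.+1%:R = 2 * (e / (2 * L.+1%:R)) by field.
  apply: normc_fourier_coef_le => [|t /=]; last by rewrite mulN1r.
  exact: ccontD cF (ccontM (ccont_cst _) cs).
apply: (@le_trans _ _ (norm_psum (fsum u K) L + e)).
  rewrite /norm_psum; apply: (@le_trans _ _ (\sum_(k < L)
     (normc (fourier_coef (fsum u K) (zenum k)) + e / L.+1%:R))).
    by apply: ler_sum => k _; exact: hc.
  rewrite big_split /= lerD2l sumr_const card_ord.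
  rewrite (_ : _ *+ L = L%:R * (e / L.+1%:R)); last by rewrite mulr_natl.
  rewrite mulrCA ger_pMr// ler_pdivrMr// mul1r ler_nat//.
rewrite lerD2r; apply: (le_trans (norm_psum_le _ As)); apply: le_trans nAs _; exact: uB.
Qed.

End FourierNorm.

(** * Inversion, products and affine substitutions *)

Section Algebra.
Context {R : realType}.
Local Notation Re := complex.Re.
Local Notation Im := complex.Im.
Implicit Types (z w : R[i]) (f g : R -> R[i]).

(** Both sum M and sum (a + M) are bounded and nondecreasing, hence have suprema,
    whose difference is the sum of a; the bound on the remainders follows from the
    monotonicity alone. *)
Lemma dominated_series (a M : nat -> R) B : (forall k, `|a k| <= M k) ->
  (forall K, \sum_(k < K) M k <= B) ->
  exists l, forall K, `|l - \sum_(k < K) a k| <= 2 * (B - \sum_(k < K) M k).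
Proof.
move=> aM MB; pose T K := \sum_(k < K) M k; pose U K := \sum_(k < K) (a k + M k).
have TS K : T K.+1 = T K + M K by rewrite /T big_ord_recr.
have US K : U K.+1 = U K + (a K + M K) by rewrite /U big_ord_recr.
have aM' k : 0 <= a k + M k <= 2 * M k by have := aM k; rewrite ler_norml; lra.
have TM K d : T K <= T (K + d)%N.
  elim: d => [|d IH]; first by rewrite addn0.
  by rewrite addnS TS; have := aM' (K + d)%N; lra.
have UM K d : U K <= U (K + d)%N <= U K + 2 * (T (K + d)%N - T K).
  elim: d => [|d IH]; first by rewrite addn0 subrr mulr0 addr0 lexx.
  by rewrite addnS TS US; have := aM' (K + d)%N; lra.
have UB K L : U L <= U K + 2 * (B - T K).
  have := MB (K + L)%N; rewrite -/(T _); have := UM K L; have := UM L K.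
  rewrite (addnC L K); lra.
have TB K L : T L <= T K + (B - T K) by have := MB L; rewrite -/(T _); lra.
have hs (V : nat -> R) (c : nat -> R) : (forall K L, V L <= V K + c K) ->
    forall K, V K <= sup (range V) <= V K + c K.
  move=> h K; have hV : has_sup (range V).
    by split; [exists (V 0%N); exists 0%N|exists (V 0%N + c 0%N) => _ [L _ <-]].
  apply/andP; split; first by apply: sup_upper_bound => //; exists K.
  by apply: ge_sup; [case: hV|move=> _ [L _ <-]].
(* U K - T K is the K-th partial sum of a. *)
exists (sup (range U) - sup (range T)) => K.
have -> : \sum_(k < K) a k = U K - T K by rewrite /U big_split /= addrK.
have := hs _ _ UB K; have := hs _ _ TB K; rewrite -/(T K) ler_norml; lra.
Qed.

Lemma chr_series (c : nat -> R[i]) (n : nat -> int) B :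
  (forall K, \sum_(k < K) normc (c k) <= B) ->
  exists F, forall K t, normc (F t - fsum (fun k => c k \*o chr (n k)) K t) <=
    4 * (B - \sum_(k < K) normc (c k)).
Proof.
move=> cB.
have hn t k : normc (c k * chr (n k) t) = normc (c k).
  by rewrite ComplexField.Normc.normcM normc_chr mulr1.
have hr t : exists l, forall K, `|l - \sum_(k < K) Re (c k * chr (n k) t)| <=
    2 * (B - \sum_(k < K) normc (c k)).
  apply: (@dominated_series (fun k => Re (c k * chr (n k) t))
    (fun k => normc (c k)) B _ cB) => k.
  by rewrite -(hn t) ler_Re.
have hi t : exists l, forall K, `|l - \sum_(k < K) Im (c k * chr (n k) t)| <=
    2 * (B - \sum_(k < K) normc (c k)).
  apply: (@dominated_series (fun k => Im (c k * chr (n k) t))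
    (fun k => normc (c k)) B _ cB) => k.
  by rewrite -(hn t) ler_Im.
have [r /= Hr] := choice hr; have [i /= Hi] := choice hi.
exists (fun t => (r t +i* i t)%C) => K t; apply: (le_trans (normc_le_ReIm _)).
rewrite cReB cImB.
have -> : Re (fsum (fun k => c k \*o chr (n k)) K t) = \sum_(k < K) Re (c k * chr (n k) t).
  by rewrite /fsum; elim/big_rec2: _ => //= k x y _ <-; rewrite cReD.
have -> : Im (fsum (fun k => c k \*o chr (n k)) K t) = \sum_(k < K) Im (c k * chr (n k) t).
  by rewrite /fsum; elim/big_rec2: _ => //= k x y _ <-; rewrite cImD.
by have := Hr t K; have := Hi t K => /=; lra.
Qed.

Definition fourier_term f k := fourier_coef f (zenum k) \*o chr (zenum k).
Definition fourier_part f K := fsum (fourier_term f) K.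

Lemma fourier_algebra_term f k : fourier_algebra (fourier_term f k) /\
  fourier_norm (fourier_term f k) <= normc (fourier_coef f (zenum k)).
Proof.
have [Ac nc] := @fourier_algebra_chr R (zenum k).
have [h1 h2] := fourier_algebraZ (fourier_coef f (zenum k)) Ac.
split; first exact: h1.
by apply: le_trans h2 _; rewrite ler_piMr// normc_ge0.
Qed.

Lemma fourier_coef_part f K k :
  fourier_coef (fourier_part f K) (zenum k) =
  if (k < K)%N then fourier_coef f (zenum k) else 0.
Proof.
have cu j : ccont (fourier_term f j) := fourier_algebra_ccont (fourier_algebra_term f j).1.
have [_ ->] := fourier_coef_fsum K (zenum k) cu.
have h j : fourier_coef (fourier_term f j) (zenum k) =
    fourier_coef f (zenum j) * (k == j)%:R.
  rewrite fourier_coefZ ?fourier_coef_chr; last exact: ccont_chr.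
  by rewrite (can_eq zenumK).
case: ltnP => [kK|Kk].
  rewrite (bigD1 (Ordinal kK))//= h eqxx mulr1 big1 ?addr0// => j jk.
  by rewrite h eq_sym (_ : (j : nat) == k = false) ?mulr0//; exact: negbTE.
rewrite big1// => j _; rewrite h gtn_eqF ?mulr0//.
exact: leq_trans (ltn_ord j) Kk.
Qed.

Lemma unif_cvg_tail (u : nat -> R -> R[i]) F f : fourier_algebra f ->
  (forall K t, normc (F t - fsum u K t) <= 4 * (fourier_norm f - norm_psum f K)) ->
  unif_cvg u F.
Proof.
move=> Af h e e0; have e4 : 0 < e / 4 by rewrite divr_gt0.
have [K0 hK0] := norm_psum_tail Af e4; exists K0 => K KK t.
by have := norm_psum_homo f KK; have := h K t; lra.
Qed.

(** The Fourier series of f converges uniformly to some F in A(T), and F has the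
    same Fourier coefficients as f, so the uniqueness theorem gives F = f. *)
Lemma fourier_inversion f K t : fourier_algebra f ->
  normc (f t - fourier_part f K t) <= 4 * (fourier_norm f - norm_psum f K).
Proof.
move=> Af; have [pf cf _] := (fourier_algebraP f).1 Af.
have [F HF] :=
  @chr_series (fun k => fourier_coef f (zenum k)) zenum _ (fun K => norm_psum_le K Af).
have uF : unif_cvg (fourier_term f) F by exact: (unif_cvg_tail Af).
have At k := (fourier_algebra_term f k).1.
have ct k : ccont (fourier_term f k) := fourier_algebra_ccont (At k).
have tB L : \sum_(k < L) fourier_norm (fourier_term f k) <= fourier_norm f.
  apply: (@le_trans _ _ (norm_psum f L)); last exact: norm_psum_le.
  by apply: ler_sum => k _; exact: (fourier_algebra_term f k).2.
have [AF _] := fourier_algebra_complete At tB uF.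
have [pF cF _] := (fourier_algebraP F).1 AF.
suff fF x : f x = F x by rewrite fF; exact: (HF K t).
have cF' : ccont ((- 1) \*o F) := ccontM (ccont_cst _) cF.
apply/eqP; rewrite -subr_eq0; apply/eqP.
have := @fourier_coef0_eq0 _ (f \+ (- 1) \*o F) => /= h; rewrite -mulN1r; apply: h.
- exact: ccontD.
- by move=> y /=; rewrite pf pF.
move=> n; rewrite fourier_coefD// fourier_coefZ// mulN1r.
apply: normc_le_all_eq0 => e e0; have [K0 hK0] := unif_cvg_coef n ct uF e0.
have := hK0 _ (leq_maxl K0 (zindex n).+1).
set L := maxn _ _.
have [_ <-] := fourier_coef_fsum L n ct.
rewrite -/(fourier_part f L) -{2}(zindexK n) fourier_coef_part leq_maxr zindexK.
by rewrite normcB.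
Qed.

Lemma normc_le_fourier_norm f t : fourier_algebra f -> normc (f t) <= fourier_norm f.
Proof.
move=> Af; apply/ler_addgt0Pr => e e0; have e4 : 0 < e / 4 by rewrite divr_gt0.
have [K hK] := norm_psum_tail Af e4.
have := fourier_inversion K t Af.
have -> : f t = (f t - fourier_part f K t) + fourier_part f K t by rewrite subrK.
rewrite addrK => h; apply: (le_trans (normcD _ _)).
suff : normc (fourier_part f K t) <= norm_psum f K by lra.
apply: (le_trans (normc_sum _ _ _)); apply: ler_sum => k _.
by rewrite ComplexField.Normc.normcM normc_chr mulr1.
Qed.

Lemma fourier_algebra_remainder f K : fourier_algebra f ->
  fourier_algebra (f \- fourier_part f K) /\
  fourier_norm (f \- fourier_part f K) <= fourier_norm f - norm_psum f K.
Proof.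
move=> Af; have [Ap _] := fourier_algebra_fsum K (fun k => (fourier_algebra_term f k).1).
have Ar := fourier_algebraB Af Ap.
have [pr cr _] := (fourier_algebraP _).1 Ar.
have cf := fourier_algebra_ccont Af; have cp := fourier_algebra_ccont Ap.
have coefE k : fourier_coef (f \- fourier_part f K) (zenum k) =
    if (k < K)%N then 0 else fourier_coef f (zenum k).
  have -> : f \- fourier_part f K = f \+ (- 1) \*o fourier_part f K.
    by apply/funext => t /=; rewrite mulN1r.
  rewrite fourier_coefD//; last exact: ccontM (ccont_cst _) cp.
  rewrite fourier_coefZ// fourier_coef_part mulN1r.
  by case: ifP; rewrite ?subrr// oppr0 addr0.
have sE d : norm_psum f K + norm_psum (f \- fourier_part f K) (K + d) = norm_psum f (K + d).
  elim: d => [|d IH].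
    rewrite addn0 {2}/norm_psum big1 ?addr0// => k _.
    by rewrite coefE ltn_ord ComplexField.Normc.normc0.
  rewrite addnS {2 3}/norm_psum !big_ord_recr /= addrA; congr (_ + normc _) => //.
  by rewrite coefE ltnNge leq_addr.
apply: fourier_algebra_of_norm_psum => // L.
apply: (le_trans (norm_psum_homo _ (leq_addl K L))).
have := sE L; have := norm_psum_le (K + L) Af; lra.
Qed.

(** If F is obtained by moving every character occurring in f to a multiple, by a
    factor of modulus at most 1, of another character, then the norm does not
    increase.  The functions n and w describe the move, and several characters may be
    moved to the same one.  The hypothesis says that, up to modulus, the remainders of
    F take only values that those of f take, which makes the convergence uniform. *)
Lemma fourier_transport f F (n : nat -> int) (w : nat -> R[i]) : fourier_algebra f ->
  (forall k, normc (w k) <= 1) ->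
  (forall K t, exists s, normc (F t - fsum (fun k =>
     (fourier_coef f (zenum k) * w k) \*o chr (n k)) K t) =
     normc (f s - fourier_part f K s)) ->
  fourier_algebra F /\ fourier_norm F <= fourier_norm f.
Proof.
move=> Af w1 hF.
have Au k : fourier_algebra ((fourier_coef f (zenum k) * w k) \*o chr (n k)) /\
    fourier_norm ((fourier_coef f (zenum k) * w k) \*o chr (n k)) <=
      normc (fourier_coef f (zenum k)).
  have [Ac nc] := @fourier_algebra_chr R (n k).
  have [h1 h2] := fourier_algebraZ (fourier_coef f (zenum k) * w k) Ac.
  split; first exact: h1.
  apply: le_trans h2 _; rewrite ComplexField.Normc.normcM -mulrA ler_piMr ?normc_ge0//.
  by rewrite -[leRHS]mulr1 ler_pM ?normc_ge0 ?fourier_norm_ge0.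
apply: (fourier_algebra_complete (fun k => (Au k).1)).
  move=> K; apply: (@le_trans _ _ (norm_psum f K)); last exact: norm_psum_le.
  by apply: ler_sum => k _; exact: (Au k).2.
apply: (unif_cvg_tail Af) => K t; have [s ->] := hF K t.
exact: fourier_inversion.
Qed.

Lemma fourier_algebra_chrM m f : fourier_algebra f ->
  fourier_algebra (chr m \* f) /\ fourier_norm (chr m \* f) <= fourier_norm f.
Proof.
move=> Af; apply: (fourier_transport (n := fun k => zenum k + m) (w := fun=> 1) Af).
  by move=> k; rewrite ComplexField.Normc.normc1.
move=> K t; exists t.
have -> : fsum (fun k => (fourier_coef f (zenum k) * 1) \*o chr (zenum k + m)) K t =
    chr m t * fourier_part f K t.
  rewrite /fourier_part /fsum mulr_sumr; apply: eq_bigr => k _ /=.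
  by rewrite /fourier_term /= chrD; ring.
by rewrite /= -mulrBr ComplexField.Normc.normcM normc_chr mul1r.
Qed.

Definition affine f (N : int) (x t : R) := f (N%:~R * t - x).

Lemma chr_affine m N x t :
  affine (chr m) N x t = expi (- (m%:~R * x)) * chr (m * N) t :> R[i].
Proof.
rewrite /affine /chr -expiD; congr expi; rewrite rmorphM /=; ring.
Qed.

(** The substitution moves the character m to mN; for N = 0 all of them are moved to
    the trivial one. *)
Lemma fourier_algebra_affine f N x : fourier_algebra f ->
  fourier_algebra (affine f N x) /\ fourier_norm (affine f N x) <= fourier_norm f.
Proof.
move=> Af; apply: (fourier_transport (n := fun k => zenum k * N)
  (w := fun k => expi (- ((zenum k)%:~R * x))) Af).
  by move=> k; rewrite normc_expi.
move=> K t; exists (N%:~R * t - x); congr (normc (_ - _)).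
rewrite /fourier_part /fsum; apply: eq_bigr => k _; rewrite /fourier_term /=.
by rewrite -mulrA; congr (_ * _); rewrite -chr_affine.
Qed.

(** A(T) is a Banach algebra: expand only the first factor and use that
    multiplication by a character does not increase the norm. *)
Lemma fourier_algebraM f g : fourier_algebra f -> fourier_algebra g ->
  fourier_algebra (f \* g) /\
  fourier_norm (f \* g) <= fourier_norm f * fourier_norm g.
Proof.
move=> Af Ag.
pose u k := fourier_coef f (zenum k) \*o (chr (zenum k) \* g).
have Au k : fourier_algebra (u k) /\
    fourier_norm (u k) <= normc (fourier_coef f (zenum k)) * fourier_norm g.
  have [Ac nc] := fourier_algebra_chrM (zenum k) Ag.
  have [h1 h2] := fourier_algebraZ (fourier_coef f (zenum k)) Ac.
  split; first exact: h1.
  by apply: le_trans h2 _; rewrite ler_wpM2l// normc_ge0.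
apply: (fourier_algebra_complete (fun k => (Au k).1)).
  move=> K; apply: (@le_trans _ _ (norm_psum f K * fourier_norm g)); last first.
    by rewrite ler_wpM2r ?fourier_norm_ge0// norm_psum_le.
  by rewrite /norm_psum mulr_suml; apply: ler_sum => k _; exact: (Au k).2.
move=> e e0.
have n1 : 0 < fourier_norm g + 1 by rewrite ltr_wpDl ?fourier_norm_ge0.
have e4 : 0 < e / (4 * (fourier_norm g + 1)) by rewrite divr_gt0// mulr_gt0.
have [K0 hK0] := norm_psum_tail Af e4; exists K0 => K KK t.
have -> : fsum u K t = fourier_part f K t * g t.
  rewrite /fourier_part /fsum mulr_suml; apply: eq_bigr => k _.
  by rewrite /u /fourier_term /= mulrA.
rewrite -mulrBl ComplexField.Normc.normcM.
have hg := normc_le_fourier_norm t Ag.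
have hf := fourier_inversion K t Af.
have hK := norm_psum_homo f KK.
have -> : e = 4 * (e / (4 * (fourier_norm g + 1))) * (fourier_norm g + 1).
  by field; rewrite gt_eqF.
apply: ler_pM; [exact: normc_ge0|exact: normc_ge0|lra|].
by apply: le_trans hg _; rewrite lerDl.
Qed.

Definition linear_on_algebra (L : (R -> R[i]) -> R[i]) := forall a f g,
  fourier_algebra f -> fourier_algebra g -> L (a \*o f \+ g) = a * L f + L g.

Lemma linear_on_algebra0 L : linear_on_algebra L -> L (fun=> 0) = 0.
Proof.
move=> Ll; have [A0 _] := fourier_algebra0 (R := R).
have := Ll 1 _ _ A0 A0.
have -> : 1 \*o (fun=> 0) \+ (fun=> 0) = (fun=> 0) :> (R -> R[i]).
  by apply/funext => t /=; rewrite mulr0 addr0.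
by rewrite mul1r => /eqP; rewrite -subr_eq subrr => /eqP <-.
Qed.

Lemma linear_on_algebra_fsum L (c : nat -> R[i]) (u : nat -> R -> R[i]) K :
  linear_on_algebra L ->
  (forall k, fourier_algebra (u k)) ->
  L (fsum (fun k => c k \*o u k) K) = \sum_(k < K) c k * L (u k).
Proof.
move=> Ll Au; elim: K => [|K IH]; first by rewrite fsum0 linear_on_algebra0// big_ord0.
rewrite big_ord_recr /= -IH addrC -Ll//.
  by rewrite fsumS; congr L; apply/funext => t /=; rewrite addrC.
by apply: (fourier_algebra_fsum K (fun k => (fourier_algebraZ (c k) (Au k)).1)).1.
Qed.

(** The norm of A(T) is an l^1 norm, so the characters determine the norm of a
    bounded functional.  The bound M serves to discard the remainder of the Fourier
    series. *)
Lemma linear_bound_of_chr L M C : linear_on_algebra L -> 0 <= M ->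
  (forall f, fourier_algebra f -> normc (L f) <= M * fourier_norm f) ->
  (forall n, normc (L (chr n)) <= C) ->
  forall f, fourier_algebra f -> normc (L f) <= C * fourier_norm f.
Proof.
move=> Ll M0 LM LC f Af; apply/ler_addgt0Pr => e e0.
have C0 : 0 <= C := le_trans (normc_ge0 _) (LC 0).
have M1 : 0 < M + 1 by lra.
have eM : 0 < e / (M + 1) by rewrite divr_gt0.
have [K hK] := norm_psum_tail Af eM.
have [Ar nr] := fourier_algebra_remainder K Af.
have [Ap _] := fourier_algebra_fsum K (fun k => (fourier_algebra_term f k).1).
have -> : f = 1 \*o (f \- fourier_part f K) \+ fourier_part f K.
  by apply/funext => t /=; rewrite mul1r subrK.
rewrite Ll// mul1r.
have -> : 1 \*o (f \- fourier_part f K) \+ fourier_part f K = f.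
  by apply/funext => t /=; rewrite mul1r subrK.
apply: (le_trans (normcD _ _)).
have h1 : normc (L (f \- fourier_part f K)) <= e.
  apply: (le_trans (LM _ Ar)).
  apply: (@le_trans _ _ ((M + 1) * (e / (M + 1)))); last first.
    by rewrite mulrCA divff ?mulr1 ?gt_eqF.
  apply: ler_pM M0 (fourier_norm_ge0 _) _ _; first by rewrite lerDl.
  by apply: le_trans nr _; rewrite lerBlDl -lerBlDr ltW.
have h2 : normc (L (fourier_part f K)) <= C * norm_psum f K.
  have -> : L (fourier_part f K) =
    \sum_(k < K) fourier_coef f (zenum k) * L (chr (zenum k)) :=
    linear_on_algebra_fsum (fun k => fourier_coef f (zenum k)) K Ll
      (fun k => (fourier_algebra_chr (zenum k)).1).
  apply: (le_trans (normc_sum _ _ _)); rewrite /norm_psum mulr_sumr; apply: ler_sum => k _.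
  by rewrite ComplexField.Normc.normcM mulrC ler_wpM2r// normc_ge0.
have h3 : C * norm_psum f K <= C * fourier_norm f by rewrite ler_wpM2l// norm_psum_le.
lra.
Qed.

End Algebra.

(** * A bump function with explicit Fourier coefficients *)

Section Bump.
Context {R : realType}.
Local Notation mu := (@lebesgue_measure R).
Local Notation Re := complex.Re.
Local Notation Im := complex.Im.
Local Notation "x %:C" := (real_complex_def (Phant R) x) : ring_scope.
Implicit Types (z w : R[i]) (f g : R -> R[i]).

Lemma sum_zenum (V : zmodType) (v : int -> V) K :
  \sum_(k < K.*2.+1) v (zenum k) = v 0 + \sum_(i < K) (v i.+1%:Z + v (- i.+1%:Z)).
Proof.
elim: K => [|K IH]; first by rewrite big_ord_recr !big_ord0 /= add0r addr0.
rewrite doubleS big_ord_recr big_ord_recr /= IH big_ord_recr /= -!addrA; congr (_ + (_ + _)).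
rewrite /zenum /= odd_double /= uphalf_double doubleK /= NegzE addrC.
by rewrite ?odd_double.
Qed.

Lemma Rintegral_odd (h : R -> R) b : 0 <= b -> continuous h ->
  (forall t, h (- t) = - h t) ->
  \int[mu]_(t in `[- b, b]) h t = 0.
Proof.
move=> b0 ch hN.
suff : \int[mu]_(t in `[- b, b]) h t = - \int[mu]_(t in `[- b, b]) h t by lra.
have ab : - b <= b by lra.
have := @integration_by_substitution_oppr R h (- b) b ab; rewrite opprK => hsub.
have {}hsub := congr1 fine (hsub (continuous_subspaceT ch)).
have -> : - (\int[mu]_(t in `[- b, b]) h t) = \int[mu]_(t in `[- b, b]) (- 1 * h t).
  by rewrite RintegralZl ?mulN1r//; exact: continuous_integrable.
rewrite [LHS]hsub.
by apply: (@eq_Rintegral _ _ _ mu) => t _ /=; rewrite hN mulN1r.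
Qed.

Lemma sin_le (x : R) : 0 < x -> `|sin x| <= x.
Proof.
move=> x0; have dS (t : R) : is_derive t (1 : R) sin (cos t) by exact: is_derive_sin.
have := Rintegral_FTC2 x0 (@continuous_cos R) dS; rewrite sin0 subr0 => <-.
have := normr_Rintegral_le (ltW x0) (@continuous_cos R) (@cos_max R).
by rewrite mul1r subr0.
Qed.

Lemma cos_ge (x : R) : 0 < x -> 1 - x ^+ 2 / 2 <= cos x.
Proof.
move=> x0; have x2 : 0 < x / 2 by rewrite divr_gt0.
have -> : x = (x / 2) *+ 2 by rewrite -mulr_natr divfK.
have := sin_le x2; have := cos2Dsin2 (x / 2); rewrite cos_mulr2n ler_norml.
nra.
Qed.

(** Any small positive level keeps the supports of the bump and of its translate by
    pi apart; it must be small because the first Fourier coefficient has to dominate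
    the later ones. *)
Definition level : R := 1 / 10.
Definition radius : R := acos level.

Lemma cos_radius : cos radius = level.
Proof. by rewrite /radius acosK// in_itv /=; rewrite /level; lra. Qed.

Lemma radius_bounds : 14 / 10 <= radius <= 2 /\ radius <= pi.
Proof.
have k1 : -1 <= level <= 1 by rewrite /level; lra.
have b0 := acos_ge0 k1; have bp := acos_lepi k1.
have p2 := @pi_ge2 R.
split=> //; apply/andP; split; rewrite leNgt -ltr_cos ?in_itv /= ?b0 ?bp//;
  rewrite ?cos_radius -?leNgt /level; try lra.
  have -> : 14 / 10 = (7 / 10) *+ 2 :> R by rewrite -mulr_natr; field.
  rewrite cos_mulr2n; have h7 : 0 < 7 / 10 :> R by lra.
  have := cos_ge h7; nra.
by have := @cos2_lt0 R; lra.
Qed.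

Definition cosbump (t : R) : R[i] := (Num.max (cos t - level) 0)%:C.

Lemma ccont_cosbump : ccont cosbump.
Proof.
apply: ccont_ReIm => t /=; last exact: cvg_cst.
apply: (@continuous_max R R (fun t => cos t - level) (cst 0)); last exact: cvg_cst.
by apply: cvgB; [exact: continuous_cos|exact: cvg_cst].
Qed.

Lemma periodic_cosbump : periodic cosbump (pi *+ 2).
Proof. by move=> t; rewrite /cosbump cosD2pi. Qed.

(** This is 2 pi times the Fourier coefficient of index n of the bump; the bump is
    even, so that the sine integrals vanish. *)
Definition bump_int (n : int) : R :=
  \int[mu]_(t in `[- radius, radius]) ((cos t - level) * cos (n%:~R * t)).

Lemma cosbump_restrict t (h : R) :
  t \in `[- pi, pi]%R -> Num.max (cos t - level) 0 * h =
  ((fun t => (cos t - level) * h) \_ [set` `[- radius, radius]]) t.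
Proof.
rewrite in_itv /= => tI; have [/andP[b1 b2] bp] := radius_bounds.
rewrite patchE /=; case: ifPn; rewrite ?notin_setE ?inE /= in_itv /= => tb.
  rewrite max_l// subr_ge0 -cos_radius; apply: ge_cos_near; first lra.
  by rewrite ler_norml.
rewrite max_r ?mul0r// subr_le0 -cos_radius; apply: le_cos_far; first lra.
apply/andP; split; last by rewrite ler_norml; lra.
by rewrite leNgt; apply/negP => /ltW; rewrite ler_norml.
Qed.

Lemma fourier_coef_cosbump n : fourier_coef cosbump n = ((pi *+ 2)^-1 * bump_int n)%:C.
Proof.
have [/andP[b1 b2] bp] := radius_bounds.
have bp' : - pi <= - radius by rewrite lerN2.
have hRe (t : R) : t \in `[- pi, pi]%R -> Re ((cosbump \* chr (- n)) t) =
    ((fun t => (cos t - level) * cos (n%:~R * t))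
       \_ [set` `[- radius, radius]]) t.
  move=> tI; change (Re (cosbump t * chr (- n) t) =
    ((fun t => (cos t - level) * cos (n%:~R * t))
       \_ [set` `[- radius, radius]]) t).
  rewrite cReM /= mul0r subr0 cosbump_restrict// !patchE; case: ifP => // _.
  by rewrite rmorphN mulNr cosN.
have hIm (t : R) : t \in `[- pi, pi]%R -> Im ((cosbump \* chr (- n)) t) =
    ((fun t => (cos t - level) * sin ((- n)%:~R * t))
       \_ [set` `[- radius, radius]]) t.
  move=> tI; change (Im (cosbump t * chr (- n) t) =
    ((fun t => (cos t - level) * sin ((- n)%:~R * t))
       \_ [set` `[- radius, radius]]) t).
  by rewrite cImM /= mul0r addr0 cosbump_restrict// !patchE; case: ifP => // _.
rewrite fourier_coefE rmorphM; congr (_ * _); apply: complex_ext.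
  change (\int[mu]_(t in `[- pi, pi]) Re ((cosbump \* chr (- n)) t) = bump_int n).
  rewrite /bump_int (Rintegral_sub _ bp' bp); apply: eq_Rintegral => t; rewrite inE => tI.
  exact: hRe.
change (\int[mu]_(t in `[- pi, pi]) Im ((cosbump \* chr (- n)) t) = 0).
transitivity (\int[mu]_(t in `[- radius, radius])
    ((cos t - level) * sin ((- n)%:~R * t))).
  rewrite (Rintegral_sub _ bp' bp); apply: eq_Rintegral => t; rewrite inE => tI.
  exact: hIm.
apply: Rintegral_odd; first lra.
  move=> t; apply: cvgM.
    by apply: cvgB; [exact: continuous_cos|exact: cvg_cst].
  exact: (ccont_Im (ccont_chr (- n))).
by move=> t; rewrite cosN mulrN sinN mulrN.
Qed.

Lemma continuous_bump_integrand (n : int) :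
  continuous (fun t : R => (cos t - level) * cos (n%:~R * t)).
Proof.
move=> t; apply: cvgM.
  by apply: cvgB; [exact: continuous_cos|exact: cvg_cst].
exact: (ccont_Re (ccont_chr n)).
Qed.

Lemma bump_intN n : bump_int (- n) = bump_int n.
Proof. by apply: eq_Rintegral => t _; rewrite rmorphN mulNr cosN. Qed.

Lemma radius_lt : - radius < radius.
Proof. by have [/andP[b1 b2] bp] := radius_bounds; lra. Qed.

Lemma bump_int0 : `|bump_int 0| <= 2.
Proof.
have dS (x : R) : is_derive x (1 : R) (fun t : R => sin t - level * t)
   ((cos x - level) * cos (0%:~R * x)).
  by apply: is_derive_eq; rewrite /GRing.scale /= mul0r cos0; ring.
rewrite /bump_int (Rintegral_FTC2 radius_lt (@continuous_bump_integrand 0) dS) sinN.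
have [/andP[b1 b2] bp] := radius_bounds.
have s1 : 0 <= sin radius by apply: sin_ge0_pi; lra.
have := @sin_le1 R radius; rewrite ler_norml /level; lra.
Qed.

(** The value is radius - sin radius * level. *)
Lemma bump_int1 : 13 / 10 <= bump_int 1 <= 2.
Proof.
have dS (x : R) : is_derive x (1 : R)
   (fun t : R => 2^-1 * (t + sin t * cos t) - level * sin t)
   ((cos x - level) * cos (1%:~R * x)).
  apply: is_derive_eq; rewrite /GRing.scale /= mul1r.
  by have := sin2cos2 x; lra.
rewrite /bump_int (Rintegral_FTC2 radius_lt (@continuous_bump_integrand 1) dS).
rewrite sinN cosN cos_radius.
have [/andP[b1 b2] bp] := radius_bounds.
have s1 : 0 <= sin radius by apply: sin_ge0_pi; lra.
have := @sin_le1 R radius; rewrite /level; lra.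
Qed.

(** The bump is continuous and piecewise smooth, so its coefficients decay like m^-2,
    with m = i + 2; the denominator m^2 - 1 is (i + 1) (i + 3), whose inverse has
    telescoping sums. *)
Lemma bump_int_ge2 (i : nat) : `|bump_int i.+2%:Z| <= 21 / 10 * (i.+1%:R * i.+3%:R)^-1.
Proof.
set m : R := i.+2%:R.
have mE : (i.+2%:Z)%:~R = m by [].
have m2 : 2 <= m by rewrite /m ler_nat.
have -> : i.+1%:R * i.+3%:R = m ^+ 2 - 1 :> R.
  by rewrite /m -!natr1; ring.
clearbody m.
have m0 : m != 0 by rewrite gt_eqF//; lra.
have mm0 : m ^+ 2 - 1 != 0 by rewrite gt_eqF//; nra.
have mm1 : 0 < m ^+ 2 - 1 by nra.
have dS (x : R) : is_derive x (1 : R) (fun t : R =>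
   (m ^+ 2 - 1)^-1 * (m * (cos t * sin (m * t)) - sin t * cos (m * t))
     - level / m * sin (m * t))
   ((cos x - level) * cos ((i.+2%:Z)%:~R * x)).
  by rewrite mE; apply: is_derive_eq; rewrite /GRing.scale /=; field; rewrite m0.
rewrite /bump_int (Rintegral_FTC2 radius_lt (@continuous_bump_integrand _) dS).
rewrite !mulrN !sinN !cosN cos_radius.
have [/andP[b1 b2] bp] := radius_bounds.
have s1 : 0 <= sin radius by apply: sin_ge0_pi; lra.
have s2 := @sin_le1 R radius.
rewrite [X in `|X|](_ : _ =
  2 * (level * sin (m * radius) / m - sin radius * cos (m * radius))
    * (m ^+ 2 - 1)^-1); last by field; rewrite mm0.
rewrite normrM (gtr0_norm (_ : 0 < (m ^+ 2 - 1)^-1)) ?invr_gt0//.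
rewrite ler_pM2r ?invr_gt0// normrM ger0_norm//.
suff : `|level * sin (m * radius) / m - sin radius * cos (m * radius)| <= 21 / 20.
  by lra.
apply: (le_trans (ler_normB _ _)).
have h1 : `|level * sin (m * radius) / m| <= 1 / 10 * 1 / 2.
  have hk : `|level| <= 1 / 10 by rewrite ger0_norm /level; lra.
  have hm : `|m|^-1 <= 2^-1 by rewrite lef_pV2 ?posrE ?normr_gt0// ger0_norm; lra.
  have hs := ler_pM (normr_ge0 _) (normr_ge0 _) hk (sin_max (m * radius)).
  rewrite (normrM (level * sin (m * radius))) (normrM level) normfV.
  apply: ler_pM hs hm; last by rewrite invr_ge0.
  by rewrite mulr_ge0.
have h2 : `|sin radius * cos (m * radius)| <= 1 * 1.
  by rewrite normrM; apply: ler_pM; rewrite ?normr_ge0 ?cos_max// ger0_norm.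
lra.
Qed.

Lemma sum_telescope_le K : \sum_(i < K) (i.+1%:R * i.+3%:R)^-1 <= 3 / 4 :> R.
Proof.
suff -> : \sum_(i < K) (i.+1%:R * i.+3%:R)^-1 =
  3 / 4 - 2^-1 * (K.+1%:R^-1 + K.+2%:R^-1) :> R.
  by rewrite gerBl mulr_ge0 ?invr_ge0 ?addr_ge0.
elim: K => [|K IH]; first by rewrite big_ord0; field.
rewrite big_ord_recr /= IH -!natr1; have : 0 <= K%:R :> R by [].
set k : R := K%:R => k0; field.
by apply/and3P; split; rewrite gt_eqF//; lra.
Qed.

(** The decisive numerical fact: 441/400 < (13/10)^2 = 169/100, the lower bound for
    the square of [bump_int] at 1.  The constant 147/100 is (21/10)^2 / 3, where 1/3 is
    the largest of the inverse denominators. *)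
Lemma bump_int_sqr_tail K : \sum_(i < K) bump_int i.+2%:Z ^+ 2 <= 441 / 400 :> R.
Proof.
apply: (@le_trans _ _ (\sum_(i < K) (147 / 100) * (i.+1%:R * i.+3%:R)^-1)); last first.
  by rewrite -mulr_sumr; have := sum_telescope_le K; lra.
apply: ler_sum => i _; rewrite -real_normK ?num_real//.
have := bump_int_ge2 i; set a := (_ * _)^-1 => h.
have a0 : 0 < a by rewrite invr_gt0 mulr_gt0.
have a3 : a <= 3^-1.
  rewrite /a lef_pV2 ?posrE ?mulr_gt0// -natrM ler_nat; lia.
have := normr_ge0 (bump_int i.+2); nra.
Qed.

(** The contributions to pi |w| are at most 1 (from m = 0), 2 (from m = 1, - 1) and
    (21/10) (3/4) < 17/10 (from the rest). *)
Lemma fourier_algebra_cosbump :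
  fourier_algebra cosbump /\ pi * fourier_norm cosbump <= 47 / 10.
Proof.
have p0 := @pi_gt0 R.
suff : fourier_algebra cosbump /\ fourier_norm cosbump <= 47 / 10 / pi.
  by case=> h1 h2; split; [exact: h1|rewrite mulrC -ler_pdivlMr].
apply: fourier_algebra_of_norm_psum; [exact: periodic_cosbump|exact: ccont_cosbump|].
move=> K; apply: (le_trans (norm_psum_homo _ (_ : K <= K.+1.*2.+1)%N)); first lia.
rewrite /norm_psum (sum_zenum (fun n => normc (fourier_coef cosbump n))).
have p2 : (pi *+ 2)^-1 = pi^-1 / 2 :> R by rewrite -[pi *+ 2]mulr_natr invfM.
have hn n : normc (fourier_coef cosbump n) = (pi *+ 2)^-1 * `|bump_int n|.
  by rewrite fourier_coef_cosbump normc_real normrM gtr0_norm// invr_gt0 mulrn_wgt0.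
rewrite hn big_ord_recl /= !hn bump_intN.
have -> : \sum_(i < K) (normc (fourier_coef cosbump (lift ord0 i).+1%:Z) +
    normc (fourier_coef cosbump (- (lift ord0 i).+1%:Z))) =
   \sum_(i < K) pi^-1 * `|bump_int i.+2|.
  by apply: eq_bigr => i _; rewrite !hn bump_intN lift0 p2; set p := pi^-1; lra.
have hs : \sum_(i < K) pi^-1 * `|bump_int i.+2| <= pi^-1 * (21 / 10 * (3 / 4)).
  rewrite -mulr_sumr ler_pM2l ?invr_gt0//.
  apply: (@le_trans _ _ (\sum_(i < K) 21 / 10 * (i.+1%:R * i.+3%:R)^-1)).
    by apply: ler_sum => i _; exact: bump_int_ge2.
  by rewrite -mulr_sumr ler_pM2l// sum_telescope_le.
have h0 := bump_int0; have /andP[h1 h1'] := bump_int1.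
have pi0 : 0 < pi^-1 :> R by rewrite invr_gt0.
have n1 : `|bump_int 1| <= 2 by rewrite ger0_norm; lra.
rewrite p2; move: hs; set p := pi^-1 in pi0 *; set S := \sum_(i < K) _ => hs.
have q0 : p * `|bump_int 0| <= p * 2 by rewrite ler_pM2l.
have q1 : p * `|bump_int 1| <= p * 2 by rewrite ler_pM2l.
lra.
Qed.

End Bump.

(** * Averaging a bilinear map over translations *)

Section Averaging.
Context {R : realType}.
Local Notation "x %:C" := (real_complex_def (Phant R) x) : ring_scope.
Implicit Types (z w : R[i]) (f g : R -> R[i]).
Implicit Types (phi : (R -> R[i]) -> (R -> R[i]) -> R[i]).

#[global] Arguments zenum : simpl never.
#[global] Arguments zindex : simpl never.

(** A geometric sum of roots of unity.  The number 4K + 1 of sample points exceeds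
    twice |r|, so that the angle of the ratio lies strictly between 0 and pi up to
    sign, and the ratio is not 1. *)
Lemma sum_expi_eq0 (r : int) (K : nat) : r != 0 -> (`|r| <= K.*2)%N ->
  \sum_(p < K.*2.*2.+1) expi (- (r%:~R * (p%:R * (pi *+ 2 / K.*2.*2.+1%:R)))) = 0 :> R[i].
Proof.
move=> r0 rK; set P := K.*2.*2.+1.
pose y : R := pi *+ 2 / P%:R.
have P0 : 0 < P%:R :> R by rewrite ltr0n.
pose z : R[i] := expi (- (r%:~R * y)).
have -> : \sum_(p < P) expi (- (r%:~R * (p%:R * y))) = \sum_(p < P) z ^+ p :> R[i].
  apply: eq_bigr => p _; rewrite -expi_nat; congr expi; ring.
have zP : z ^+ P = 1.
  rewrite -expi_nat.
  have -> : P%:R * - (r%:~R * y) = (- r)%:~R * (pi *+ 2) :> R.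
    by rewrite rmorphN /y; set q := pi *+ 2; field; rewrite gt_eqF.
  exact: chr_2pi.
have z1 : z - 1 != 0.
  rewrite subr_eq0; apply/eqP => /(congr1 (@complex.Im R)) /=; rewrite sinN => /eqP.
  rewrite oppr_eq0 => /eqP sz.
  have sa : sin (`|r|%:R * y) = 0.
    case: r sz {r0 rK z zP} => n //; rewrite NegzE rmorphN mulNr sinN => /eqP.
    by rewrite oppr_eq0 => /eqP.
  have : 0 < sin (`|r|%:R * y).
    apply: sin_gt0_pi; have r1 : 1 <= `|r|%:R :> R by rewrite ler1n lt0n absz_eq0.
    have rK' : `|r|%:R <= K.*2%:R :> R by rewrite ler_nat.
    have p0 := @pi_gt0 R.
    rewrite /y mulr_gt0//=; last by rewrite divr_gt0// mulrn_wgt0.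
      rewrite mulrA ltr_pdivrMr//.
      have -> : P%:R = K.*2%:R * 2 + 1 :> R by rewrite /P -natr1 -muln2 natrM.
      nra.
    by lra.
  by rewrite sa ltxx.
apply: (mulfI z1); rewrite mulr0.
by rewrite -subrX1 zP subrr.
Qed.

Lemma expiN_intpi (n : int) : expi (- (n%:~R * pi)) = expi (n%:~R * pi) :> R[i].
Proof.
have h : expi (n%:~R * pi) * expi (n%:~R * pi) = 1 :> R[i].
  by rewrite -expiD -mulrDr -mulr2n; exact: chr_2pi.
have h' := expiK (n%:~R * pi : R).
have : expi (n%:~R * pi) != 0 :> R[i].
  apply/eqP => h0; move: h; rewrite h0 mul0r => /eqP; by rewrite eq_sym oner_eq0.
by move=> /mulfI; apply; rewrite h h'.
Qed.

Definition bounded_form phi M := [/\ bilinear_on_fourier_algebra phi, 0 <= M &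
  forall f g, fourier_algebra f -> fourier_algebra g ->
    normc (phi f g) <= M * fourier_norm f * fourier_norm g].

Definition disjoint_bound phi alpha := forall f g : R -> R[i],
  fourier_algebra f -> fourier_algebra g -> supp f `&` supp g = set0 ->
  normc (phi f g) <= alpha * fourier_norm f * fourier_norm g.

Lemma bounded_form_linl phi M g :
  bounded_form phi M -> fourier_algebra g -> linear_on_algebra (phi^~ g).
Proof. by move=> [[h _] _ _] Ag a f1 f2 A1 A2; exact: h. Qed.

Lemma bounded_form_linr phi M f :
  bounded_form phi M -> fourier_algebra f -> linear_on_algebra (phi f).
Proof. by move=> [[_ h] _ _] Af a g1 g2 A1 A2; exact: h. Qed.

(** Translating by pi changes the sign of the cosine, and the closed conditions
    cos >= 1/10 and - cos >= 1/10 exclude each other. *)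
Lemma supp_affine_cosbump N (x : R) :
  supp (affine cosbump N x) `&` supp (affine cosbump N (x + pi)) = set0.
Proof.
have hs (y : R) : supp (affine cosbump N y) `<=` [set s | level <= cos (N%:~R * s - y)].
  set C := [set s | _].
  have cf : continuous (fun s : R => cos (N%:~R * s - y)).
    move=> s; apply: (@cvg_comp _ _ _ (fun s => N%:~R * s - y) cos); last first.
      exact: continuous_cos.
    by apply: cvgB; [exact: mulrl_continuous|exact: cvg_cst].
  have cC : closed C.
    exact: (@preimage_closed R R _ [set x | level <= x] (in1W cf) (@closed_ge R level)).
  rewrite ((closure_id C).1 cC); apply: closure_subset => s /=.
  rewrite /affine /cosbump; apply: contraNP => /negP; rewrite -ltNge => h.
  by apply/eqP; rewrite max_r// subr_le0 ltW.
apply/seteqP; split => // s [/hs /= h1 /hs /= h2].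
have : cos (N%:~R * s - (x + pi)) = - cos (N%:~R * s - x).
  have -> : N%:~R * s - x = (N%:~R * s - (x + pi)) + pi by ring.
  by rewrite cosDpi opprK.
have : 0 < level :> R by rewrite /level; lra.
lra.
Qed.

Lemma affine_fourier_part f K N x : affine (fourier_part f K) N x =
  fsum (fun k => (fourier_coef f (zenum k) * expi (- ((zenum k)%:~R * x)))
    \*o chr (zenum k * N)) K.
Proof.
apply/funext => t; rewrite /affine /fourier_part /fsum; apply: eq_bigr => k _.
rewrite /fourier_term /=.
by rewrite -mulrA; congr (_ * _); rewrite -chr_affine.
Qed.

(** Replacing the two translated bumps by partial sums costs a multiple of the tail of
    the Fourier series, where the (possibly huge) bound M of phi enters. *)
Lemma normc_phi_affine_part phi M alpha N K (x : R) :
  bounded_form phi M -> disjoint_bound phi alpha -> 0 <= alpha ->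
  normc (phi (affine (fourier_part cosbump K) N x)
             (affine (fourier_part cosbump K) N (x + pi))) <=
  alpha * fourier_norm cosbump ^+ 2 +
  2 * M * fourier_norm cosbump * (fourier_norm cosbump - norm_psum cosbump K).
Proof.
move=> phiB phiD alpha0; set B := fourier_norm cosbump; set e := B - _.
have A0 : fourier_algebra (cosbump : R -> R[i]) := fourier_algebra_cosbump.1.
have [_ M0 phiM] := phiB.
have [Ap np] := fourier_algebra_fsum K (fun k => (@fourier_algebra_term R cosbump k).1).
have {}np : fourier_norm (fourier_part cosbump K) <= B.
  apply: le_trans np _; apply: le_trans (norm_psum_le K A0).
  by apply: ler_sum => k _; exact: (@fourier_algebra_term R cosbump k).2.
have [Ar nr] := fourier_algebra_remainder K A0.
set S := affine (fourier_part cosbump K) N x.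
set S' := affine (fourier_part cosbump K) N (x + pi).
pose r := affine (cosbump \- fourier_part cosbump K) N x.
pose r' := affine (cosbump \- fourier_part cosbump K) N (x + pi).
pose F := affine cosbump N x; pose F' := affine cosbump N (x + pi).
have [AS nS] := fourier_algebra_affine N x Ap.
have [AS' nS'] := fourier_algebra_affine N (x + pi) Ap.
have [AF nF] := fourier_algebra_affine N x A0.
have [AF' nF'] := fourier_algebra_affine N (x + pi) A0.
have [AR nR] := fourier_algebra_affine N x Ar.
have [AR' nR'] := fourier_algebra_affine N (x + pi) Ar.
have FE : F = 1 \*o r \+ S.
  by apply/funext => t; rewrite /F /r /S /affine /= mul1r subrK.
have FE' : F' = 1 \*o r' \+ S'.
  by apply/funext => t; rewrite /F' /r' /S' /affine /= mul1r subrK.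
have h1 : phi F F' = phi r F' + phi S F'.
  by rewrite {1}FE (bounded_form_linl phiB AF' 1 AR AS) mul1r.
have h2 : phi S F' = phi S r' + phi S S'.
  by rewrite FE' (bounded_form_linr phiB AS 1 AR' AS') mul1r.
have -> : phi S S' = phi F F' - (phi r F' + phi S r').
  by rewrite h1 h2; ring.
have B0 : 0 <= B := fourier_norm_ge0 _.
have b1 : normc (phi F F') <= alpha * B ^+ 2.
  apply: (le_trans (phiD _ _ AF AF' (supp_affine_cosbump N x))).
  rewrite -mulrA expr2; apply: (ler_wpM2l alpha0).
  by apply: ler_pM nF nF'; exact: fourier_norm_ge0.
have nr1 : fourier_norm r <= e := le_trans nR nr.
have nr2 : fourier_norm r' <= e := le_trans nR' nr.
have b2 : normc (phi r F') <= M * (e * B).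
  apply: (le_trans (phiM _ _ AR AF')); rewrite -mulrA; apply: (ler_wpM2l M0).
  by apply: ler_pM nr1 nF'; exact: fourier_norm_ge0.
have b3 : normc (phi S r') <= M * (B * e).
  apply: (le_trans (phiM _ _ AS AR')); rewrite -mulrA; apply: (ler_wpM2l M0).
  by apply: ler_pM (le_trans nS np) nr2; exact: fourier_norm_ge0.
apply: (le_trans (normcD _ _)); rewrite normcN.
have b4 := normcD (phi r F') (phi S r').
have -> : alpha * B ^+ 2 + 2 * M * B * e =
  alpha * B ^+ 2 + (M * (e * B) + M * (B * e)) by ring.
apply: lerD b1 (le_trans b4 (lerD b2 b3)).
Qed.

Lemma bounded_form_fsum phi M (c d : nat -> R[i]) (u v : nat -> R -> R[i]) K L :
  bounded_form phi M ->
  (forall k, fourier_algebra (u k)) -> (forall k, fourier_algebra (v k)) ->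
  phi (fsum (fun k => c k \*o u k) K) (fsum (fun k => d k \*o v k) L) =
  \sum_(k < K) \sum_(l < L) c k * d l * phi (u k) (v l).
Proof.
move=> phiB Au Av.
have Asv : fourier_algebra (fsum (fun k => d k \*o v k) L).
  exact: (fourier_algebra_fsum L (fun k => (fourier_algebraZ (d k) (Av k)).1)).1.
have := linear_on_algebra_fsum c K (bounded_form_linl phiB Asv) Au => /= ->.
apply: eq_bigr => k _.
have := linear_on_algebra_fsum d L (bounded_form_linr phiB (Au k)) Av => /= ->.
by rewrite mulr_sumr; apply: eq_bigr => l _; rewrite mulrA.
Qed.

(** The factor expi (n pi) is (- 1)^n; it comes from translating one of the bumps by
    pi. *)
Definition diag_weight (n : int) : R[i] :=
  (((pi *+ 2)^-1 * bump_int n) ^+ 2)%:C * expi (n%:~R * pi).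

(** Average over equally spaced translations x.  The pair of characters of indices
    Nm and Nn is multiplied by expi (- (m + n) x), so only m + n = 0 survives. *)
Lemma normc_diag_sum phi M alpha N K :
  bounded_form phi M -> disjoint_bound phi alpha -> 0 <= alpha ->
  normc (\sum_(k < K.*2.+1)
    diag_weight (zenum k) * phi (chr (zenum k * N)) (chr (- zenum k * N))) <=
  alpha * fourier_norm cosbump ^+ 2 +
  2 * M * fourier_norm cosbump * (fourier_norm cosbump - norm_psum cosbump K.*2.+1).
Proof.
move=> phiB phiD alpha0; set b := (leRHS).
set P := K.*2.*2.+1; pose X (p : nat) : R := p%:R * (pi *+ 2 / P%:R).
pose T x := phi (affine (fourier_part cosbump K.*2.+1) N x)
  (affine (fourier_part cosbump K.*2.+1) N (x + pi)).
have Tb x : normc (T x) <= b by exact: normc_phi_affine_part.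
pose a (k : nat) : R[i] := fourier_coef cosbump (zenum k).
pose ph (k l : nat) := phi (chr (zenum k * N)) (chr (zenum l * N)).
have TE x : T x = \sum_(k < K.*2.+1) \sum_(l < K.*2.+1)
    a k * a l * expi (- ((zenum l)%:~R * pi)) * ph k l *
    expi (- ((zenum k + zenum l)%:~R * x)).
  rewrite /T !affine_fourier_part.
  rewrite (@bounded_form_fsum _ _ (fun k => a k * expi (- ((zenum k)%:~R * x)))
    (fun k => a k * expi (- ((zenum k)%:~R * (x + pi))))
    (fun k => chr (zenum k * N)) (fun k => chr (zenum k * N)) _ _ phiB
    (fun k => (fourier_algebra_chr _).1) (fun k => (fourier_algebra_chr _).1)).
  apply: eq_bigr => k _; apply: eq_bigr => l _; rewrite -/(ph k l).
  have -> : expi (- ((zenum l)%:~R * (x + pi))) =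
      expi (- ((zenum l)%:~R * x)) * expi (- ((zenum l)%:~R * pi)) :> R[i].
    by rewrite -expiD; congr expi; ring.
  have -> : expi (- ((zenum k + zenum l)%:~R * x)) =
      expi (- ((zenum k)%:~R * x)) * expi (- ((zenum l)%:~R * x)) :> R[i].
    by rewrite -expiD; congr expi; rewrite rmorphD /=; ring.
  ring.
have P0 : 0 < P%:R :> R by rewrite ltr0n.
have key : \sum_(p < P) T (X p) =
    P%:R * \sum_(k < K.*2.+1)
      diag_weight (zenum k) * phi (chr (zenum k * N)) (chr (- zenum k * N)).
  under eq_bigr do rewrite TE.
  rewrite exchange_big mulr_sumr; apply: eq_bigr => k _.
  rewrite exchange_big /=.
  (* Indices have absolute value at most K, so sums of two are at most 2K, as
     the averaging lemma requires, and the opposite of an index is an index. *)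
  have zK (j : 'I_K.*2.+1) : (`|zenum j| <= K)%N.
    by rewrite /zenum; have := ltn_ord j; have := odd_double_half j; case: odd; lia.
  have kK' : (zindex (- zenum k) < K.*2.+1)%N.
    by have := zK k; case: (zenum k) => [[|n]|n] /=; rewrite ?NegzE ?opprK /zindex /=; lia.
  have diag : a k * a (zindex (- zenum k)) *
      expi (- ((zenum (zindex (- zenum k)))%:~R * pi)) * ph k (zindex (- zenum k)) =
      diag_weight (zenum k) * phi (chr (zenum k * N)) (chr (- zenum k * N)).
    rewrite /ph /a !zindexK !fourier_coef_cosbump bump_intN /diag_weight.
    rewrite rmorphN mulNr opprK.
    by rewrite -rmorphM expr2.
  rewrite (bigD1 (Ordinal kK'))//= [X in _ + X]big1 ?addr0 => [|l lk].
    under eq_bigr do rewrite diag zindexK subrr mul0r oppr0 expi0 mulr1.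
    by rewrite sumr_const card_ord mulr_natl.
  rewrite -mulr_sumr sum_expi_eq0 ?mulr0//.
    apply: contraNneq lk => kl; apply/eqP/val_inj => /=.
    by rewrite (addr0_eq kl) zenumK.
  by have := zK k; have := zK l; lia.
rewrite -(@ler_pM2l _ P%:R)//.
have -> : P%:R * normc (\sum_(k < K.*2.+1)
    diag_weight (zenum k) * phi (chr (zenum k * N)) (chr (- zenum k * N)))
   = normc (\sum_(p < P) T (X p)).
  rewrite key ComplexField.Normc.normcM; congr (_ * _).
  by rewrite -(rmorph_nat (real_complex R)) normc_real ger0_norm.
apply: (le_trans (normc_sum _ _ _)).
apply: (@le_trans _ _ (\sum_(p < P) b)); first exact: ler_sum.
by rewrite sumr_const card_ord mulr_natl.
Qed.

End Averaging.

(** * Second differences along antidiagonals *)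

Section SecondDifferences.
Context {R : realType}.
Local Notation "x %:C" := (real_complex_def (Phant R) x) : ring_scope.
Implicit Types (z w : R[i]) (f g : R -> R[i]).
Implicit Types (phi : (R -> R[i]) -> (R -> R[i]) -> R[i]).

Lemma diag_weightN n : diag_weight (- n) = diag_weight n :> R[i].
Proof. by rewrite /diag_weight bump_intN rmorphN mulNr expiN_intpi. Qed.

Lemma normc_diag_weight n :
  normc (diag_weight n : R[i]) = ((pi *+ 2)^-1) ^+ 2 * bump_int n ^+ 2.
Proof.
rewrite ComplexField.Normc.normcM normc_expi mulr1 normc_real ger0_norm ?sqr_ge0//.
by rewrite exprMn.
Qed.

Lemma pi_le4 : pi <= 4 :> R.
Proof. by have := @pihalf_lt2 R; lra. Qed.

(** Since phi vanishes at the centre, pairing n with - n leaves the symmetric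
    combinations of phi at (nN, - nN) and (- nN, nN), weighted by the squares of the
    Fourier coefficients; the first is isolated and the others are bounded by S. *)
Lemma antidiagonal_ineq phi M alpha N S :
  bounded_form phi M -> disjoint_bound phi alpha -> 0 <= alpha ->
  phi (chr 0) (chr 0) = 0 ->
  (forall n : nat, normc (phi (chr (n%:Z * N)) (chr (- n%:Z * N)) +
     phi (chr (- n%:Z * N)) (chr (n%:Z * N))) <= S) ->
  169 / 100 * normc (phi (chr N) (chr (- N)) + phi (chr (- N)) (chr N))
    <= 441 / 400 * S + 89 * alpha.
Proof.
move=> phiB phiD alpha0 phi0; 
set sd := fun n : nat => phi (chr (n%:Z * N)) (chr (- n%:Z * N)) +
  phi (chr (- n%:Z * N)) (chr (n%:Z * N)).
move=> sdS; have -> : phi (chr N) (chr (- N)) + phi (chr (- N)) (chr N) = sd 1%N.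
  by rewrite /sd mulN1r mul1r.
have [_ M0 _] := phiB.
have S0 : 0 <= S := le_trans (normc_ge0 _) (sdS 0%N).
have p0 := @pi_gt0 R; have p4 := pi_le4.
have [A0 nB] := @fourier_algebra_cosbump R.
set B := fourier_norm cosbump in nB.
have B0 : 0 <= B := fourier_norm_ge0 _.
apply/ler_addgt0Pr => e e0.
have M1 : 0 < M + 1 by lra.
(* After multiplication by (2 pi)^2 the error term is at most
   8 pi * M * (47/10) * eps <= 160 (M + 1) eps, as pi <= 4. *)
have d0 : 0 < e / (160 * (M + 1)) by apply: (divr_gt0 e0); apply: mulr_gt0.
have [K] := norm_psum_tail A0 d0; rewrite -/B => hK.
have := normc_diag_sum N K.+1 phiB phiD alpha0; rewrite -/B.
set eps := B - norm_psum _ _.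
have hK2 : norm_psum cosbump K <= norm_psum cosbump K.+1.*2.+1 :> R.
  by apply: norm_psum_homo; clear; lia.
rewrite (sum_zenum (fun n => diag_weight n * phi (chr (n * N)) (chr (- n * N)))).
rewrite oppr0 !mul0r phi0 mulr0 add0r.
under eq_bigr => i _ do rewrite diag_weightN opprK -mulrDr -/(sd i.+1).
rewrite big_ord_recl /= -/(sd 1%N) => hsum.
pose Q : R := ((pi *+ 2)^-1) ^+ 2.
have Q0 : 0 < Q by rewrite exprn_gt0// invr_gt0 mulrn_wgt0.
set tail := \sum_(i < K) _ in hsum.
have htail : normc tail <= Q * (441 / 400) * S.
  apply: (le_trans (normc_sum _ _ _)).
  apply: (@le_trans _ _ (\sum_(i < K) Q * bump_int i.+2%:Z ^+ 2 * S)).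
    apply: ler_sum => i _; rewrite ComplexField.Normc.normcM normc_diag_weight.
    by apply: ler_wpM2l (sdS _); rewrite mulr_ge0// ?sqr_ge0// ltW.
  rewrite -mulr_suml -mulr_sumr; apply: (ler_wpM2r S0); rewrite ler_pM2l//.
  exact: bump_int_sqr_tail.
have h1 : Q * bump_int 1 ^+ 2 * normc (sd 1%N) <=
    normc (diag_weight 1 * sd 1%N + tail) + normc tail.
  have := normcD (diag_weight 1 * sd 1%N + tail) (- tail).
  by rewrite addrK normcN ComplexField.Normc.normcM normc_diag_weight.
have b1 : Q * (169 / 100) * normc (sd 1%N) <= Q * bump_int 1 ^+ 2 * normc (sd 1%N).
  apply: ler_wpM2r; first exact: normc_ge0.
  by rewrite ler_pM2l//; have /andP[] := @bump_int1 R; nra.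
rewrite -(ler_pM2l Q0).
have QE : Q * (4 * pi ^+ 2) = 1.
  rewrite /Q; have gen (y : R) : 4 * y ^+ 2 = (y *+ 2) ^+ 2 by ring.
  rewrite gen.
  by rewrite -exprMn mulVf ?expr1n// gt_eqF// mulrn_wgt0.
have epsd : eps <= e / (160 * (M + 1)).
  by rewrite /eps lerBlDl -lerBlDr; apply: (le_trans (ltW hK)).
have eps0 : 0 <= eps by rewrite /eps subr_ge0 norm_psum_le.
have e1 : alpha * B ^+ 2 <= Q * (89 * alpha).
  have -> : alpha * B ^+ 2 = Q * (4 * (pi * B) ^+ 2 * alpha).
    have gen (q y b a : R) : q * (4 * y ^+ 2) * (a * b ^+ 2) =
      q * (4 * (y * b) ^+ 2 * a) by ring.
    by rewrite -gen QE mul1r.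
  rewrite ler_pM2l//; apply: (ler_wpM2r alpha0).
  have : 0 <= pi * B by rewrite mulr_ge0// ltW.
  move: nB; set y := pi * B; clear; nra.
have e2 : 2 * M * B * eps <= Q * e.
  have -> : 2 * M * B * eps = Q * (8 * pi * M * (pi * B) * eps).
    have gen (q y b m d : R) : q * (4 * y ^+ 2) * (2 * m * b * d) =
      q * (8 * y * m * (y * b) * d) by ring.
    by rewrite -gen QE mul1r.
  rewrite ler_pM2l//.
  have pB0 : 0 <= pi * B by rewrite mulr_ge0// ltW.
  have hpM : 8 * pi * M <= 32 * (M + 1).
    by move: p0 p4 M0; set y := pi; clear; nra.
  have h0 : 0 <= 8 * pi * M by rewrite mulr_ge0 ?mulr_ge0// ltW.
  have hB : 8 * pi * M * (pi * B) <= 32 * (M + 1) * 5.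
    by apply: ler_pM => //; apply: (le_trans nB); lra.
  apply: (@le_trans _ _ (32 * (M + 1) * 5 * (e / (160 * (M + 1))))).
    by apply: ler_pM hB epsd => //; rewrite mulr_ge0.
  suff -> : 32 * (M + 1) * 5 * (e / (160 * (M + 1))) = e by [].
  by move: M1; set y := M + 1; clear => y0; field; rewrite gt_eqF.
move: h1 b1 htail hsum e1 e2; lra.
Qed.

Definition second_diff phi (j l N : int) : R[i] := phi (chr (j + N)) (chr (l - N)) +
  phi (chr (j - N)) (chr (l + N)) - 2 * phi (chr j) (chr l).

Lemma supp_chrM m f : supp (chr m \* f) = supp f.
Proof.
rewrite /supp; congr closure; apply/seteqP; split => s /=; rewrite mulf_eq0 negb_or.
  by case/andP.
move=> ->; rewrite andbT; apply/eqP => /(congr1 (@ComplexField.Normc.normc R)).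
by rewrite normc_chr ComplexField.Normc.normc0 => /eqP; rewrite oner_eq0.
Qed.

(** Recentre at (j, l) and normalise to 0 at the centre by subtracting a multiple of
    the zeroth Fourier coefficient of the product.  That form takes the value 1 at
    all pairs of opposite characters and 0 on functions with disjoint supports, so
    that the disjointness hypothesis is preserved with the same alpha. *)
Lemma second_diff_ineq phi M alpha j l N S :
  bounded_form phi M -> disjoint_bound phi alpha -> 0 <= alpha ->
  (forall n : int, normc (second_diff phi j l n) <= S) ->
  169 / 100 * normc (second_diff phi j l N) <= 441 / 400 * S + 89 * alpha.
Proof.
move=> phiB phiD alpha0 d2S; have [phibil M0 phiM] := phiB.
pose c := phi (chr j) (chr l).
(* On characters, psi is phi recentred, with the constant c removed on the
   antidiagonal. *)
pose psi f g := phi (chr j \* f) (chr l \* g) - c * fourier_coef (f \* g) 0.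
have psichr p q : psi (chr p) (chr q) =
    phi (chr (j + p)) (chr (l + q)) - c * (p + q == 0)%:R.
  have chrE m n : chr m \* chr n = chr (m + n) :> (R -> R[i]).
    by apply/funext => t /=; rewrite chrD.
  by rewrite /psi !chrE fourier_coef_chr eq_sym.
have AM m f : fourier_algebra f -> fourier_algebra (chr m \* f).
  by move=> Af; exact: (fourier_algebra_chrM m Af).1.
have cAB f g : fourier_algebra f -> fourier_algebra g -> ccont (f \* g).
  by move=> Af Ag; exact: (ccontM (fourier_algebra_ccont Af) (fourier_algebra_ccont Ag)).
have chrlin m a f1 f2 :
    chr m \* (a \*o f1 \+ f2) = a \*o (chr m \* f1) \+ (chr m \* f2) :> (R -> R[i]).
  by apply/funext => t /=; ring.
have psiB : bounded_form psi (M + normc c).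
  split.
  - split=> a f1 f2 g A1 A2 Ag; rewrite /psi.
      rewrite chrlin phibil.1; [|exact: AM..].
      have -> : (a \*o f1 \+ f2) \* g = a \*o (f1 \* g) \+ (f2 \* g).
        by apply/funext => t /=; ring.
      rewrite fourier_coefD; [|exact: ccontM (ccont_cst a) (cAB _ _ A1 Ag)|exact: cAB].
      rewrite fourier_coefZ; last exact: cAB.
      ring.
    rewrite chrlin phibil.2; [|exact: AM..].
    have -> : f1 \* (a \*o f2 \+ g) = a \*o (f1 \* f2) \+ (f1 \* g).
      by apply/funext => t /=; ring.
    rewrite fourier_coefD; [|exact: ccontM (ccont_cst a) (cAB _ _ A1 A2)|exact: cAB].
    rewrite fourier_coefZ; last exact: cAB.
    ring.
  - by rewrite addr_ge0 ?normc_ge0.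
  - move=> f g Af Ag; apply: (le_trans (normcD _ _)); rewrite normcN.
    have [A1 n1] := fourier_algebra_chrM j Af; have [A2 n2] := fourier_algebra_chrM l Ag.
    have [A3 n3] := fourier_algebraM Af Ag.
    rewrite -!mulrA mulrDl; apply: lerD.
      apply: (le_trans (phiM _ _ A1 A2)); rewrite -mulrA; apply: (ler_wpM2l M0).
      by apply: ler_pM n1 n2; exact: fourier_norm_ge0.
    rewrite ComplexField.Normc.normcM; apply: (ler_wpM2l (normc_ge0 c)).
    apply: le_trans n3; have := norm_psum_le 1 A3.
    by rewrite /norm_psum big_ord_recl big_ord0 addr0.
have psiD : disjoint_bound psi alpha.
  move=> f g Af Ag fg.
  have fg0 : f \* g = 0 \*o (f \* g).
    apply/funext => t /=; rewrite mul0r; apply/eqP; rewrite mulf_eq0; apply/negPn.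
    rewrite negb_or; apply/negP => /andP[ft gt].
    have : (supp f `&` supp g) t by split; apply: subset_closure.
    by rewrite fg.
  rewrite /psi fg0 fourier_coefZ; last exact: cAB.
  rewrite mul0r mulr0 subr0.
  have [A1 n1] := fourier_algebra_chrM j Af; have [A2 n2] := fourier_algebra_chrM l Ag.
  apply: (le_trans (phiD _ _ A1 A2 _)); first by rewrite !supp_chrM.
  rewrite -!mulrA; apply: (ler_wpM2l alpha0).
  by apply: ler_pM n1 n2; exact: fourier_norm_ge0.
have psi0 : psi (chr 0) (chr 0) = 0.
  by rewrite psichr !addr0 eqxx mulr1 subrr.
have psid2 n : psi (chr n) (chr (- n)) + psi (chr (- n)) (chr n) = second_diff phi j l n.
  rewrite !psichr subrr addNr eqxx mulr1 /second_diff -/c; ring.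
rewrite -psid2; apply: (antidiagonal_ineq psiB psiD alpha0 psi0) => n.
rewrite mulNr psid2; exact: d2S.
Qed.

Lemma normc_bounded_form_chr phi M m n :
  bounded_form phi M -> normc (phi (chr m) (chr n)) <= M.
Proof.
move=> [_ M0 phiM]; have [Am nm] := @fourier_algebra_chr R m.
have [An nn] := @fourier_algebra_chr R n.
apply: (le_trans (phiM _ _ Am An)); rewrite -mulrA ler_piMr//.
by rewrite -[leRHS]mulr1; apply: ler_pM nm nn; exact: fourier_norm_ge0.
Qed.

(** The supremum of the second differences is finite because phi is bounded, so it can
    be absorbed; 89 / (169/100 - 441/400) is less than 152. *)
Lemma second_diff_bound phi M alpha j l N :
  bounded_form phi M -> disjoint_bound phi alpha -> 0 <= alpha ->
  normc (second_diff phi j l N) <= 152 * alpha.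
Proof.
move=> phiB phiD alpha0.
pose E := [set x | exists j l n, x = normc (second_diff phi j l n)].
have EB x : E x -> x <= 4 * M.
  move=> [j' [l' [n ->]]]; rewrite /second_diff; apply: (le_trans (normcD _ _)).
  have h1 := normcD (phi (chr (j' + n)) (chr (l' - n))) (phi (chr (j' - n)) (chr (l' + n))).
  have h2 := normc_bounded_form_chr (j' + n) (l' - n) phiB.
  have h3 := normc_bounded_form_chr (j' - n) (l' + n) phiB.
  have h4 := normc_bounded_form_chr j' l' phiB.
  rewrite normcN ComplexField.Normc.normcM.
  have -> : normc (2 : R[i]) = 2.
    by rewrite -[2 in LHS](rmorph_nat (real_complex R)) normc_real ger0_norm.
  lra.
have hE : has_sup E by split; [exists (normc (second_diff phi j l N)), j, l, N|exists (4 * M)].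
have ES x : E x -> x <= sup E by move=> Ex; exact: sup_upper_bound.
have h x : E x -> 169 / 100 * x <= 441 / 400 * sup E + 89 * alpha.
  move=> [j' [l' [n ->]]]; apply: second_diff_ineq phiB phiD alpha0 _ => n'.
  by apply: ES; exists j', l', n'.
have : sup E <= (441 / 400 * sup E + 89 * alpha) * (100 / 169).
  by apply: ge_sup => [|x /h]; [case: hE|lra].
have := ES _ (ex_intro _ j (ex_intro _ l (ex_intro _ N erefl))).
lra.
Qed.

(** Twice a first difference of step k is a first difference of step 2k minus a second
    difference.  Taking the finite supremum D of all first differences gives
    2D <= D + 152 alpha. *)
Lemma shift_bound_chr phi M alpha j l k :
  bounded_form phi M -> disjoint_bound phi alpha -> 0 <= alpha ->
  normc (phi (chr (j + k)) (chr l) - phi (chr j) (chr (l + k))) <= 152 * alpha.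
Proof.
move=> phiB phiD alpha0.
pose X j l k := phi (chr (j + k)) (chr l) - phi (chr j) (chr (l + k)).
have XE j' l' k' :
    X j' l' k' + X j' l' k' = X j' (l' - k') (k' + k') - second_diff phi (j' + k') l' k'.
  rewrite /X /second_diff !addrA addrK.
  have -> : l' - k' + k' + k' = l' + k' by lia.
  ring.
pose E := [set x | exists j l n, x = normc (X j l n)].
have EB x : E x -> x <= 2 * M.
  move=> [j' [l' [n ->]]]; rewrite /X; apply: (le_trans (normcD _ _)); rewrite normcN.
  have h2 := normc_bounded_form_chr (j' + n) l' phiB.
  have h3 := normc_bounded_form_chr j' (l' + n) phiB.
  lra.
have hE : has_sup E by split; [exists (normc (X j l k)), j, l, k|exists (2 * M)].
have ES x : E x -> x <= sup E by move=> Ex; exact: sup_upper_bound.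
have h x : E x -> x <= (sup E + 152 * alpha) / 2.
  move=> [j' [l' [n ->]]].
  have : normc (X j' l' n + X j' l' n) = 2 * normc (X j' l' n).
    have -> : X j' l' n + X j' l' n = 2%:C * X j' l' n.
      by rewrite (rmorph_nat (real_complex R)) mulr_natl mulr2n.
    by rewrite normcZ ger0_norm.
  rewrite XE; have := normcD (X j' (l' - n) (n + n)) (- second_diff phi (j' + n) l' n).
  rewrite normcN; have := second_diff_bound (j' + n) l' n phiB phiD alpha0.
  have := ES _ (ex_intro _ j' (ex_intro _ (l' - n) (ex_intro _ (n + n) erefl))).
  lra.
have : sup E <= (sup E + 152 * alpha) / 2 by apply: ge_sup => //; case: hE.
have := ES _ (ex_intro _ j (ex_intro _ l (ex_intro _ k erefl))).
rewrite /X; lra.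
Qed.

End SecondDifferences.

(** * From characters to the whole algebra *)

Section Extension.
Context {R : realType}.
Local Notation "x %:C" := (real_complex_def (Phant R) x) : ring_scope.
Implicit Types (z w : R[i]) (f g : R -> R[i]).
Implicit Types (phi : (R -> R[i]) -> (R -> R[i]) -> R[i]).

Lemma linear_on_algebraZ L a f :
  linear_on_algebra L -> fourier_algebra f -> L (a \*o f) = a * L f.
Proof.
move=> Ll Af; have [Az _] := @fourier_algebra0 R.
have := Ll a f _ Af Az; rewrite linear_on_algebra0// addr0 => <-.
by congr L; apply/funext => t /=; rewrite addr0.
Qed.

(** Continuity at (0, 0) and scaling.  An element of norm zero cannot be scaled, but it
    is the zero function because the norm dominates the sup norm. *)
Lemma bounded_form_of_continuous phi : bilinear_on_fourier_algebra phi ->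
  continuous_on_fourier_algebra phi -> exists M, bounded_form phi M.
Proof.
move=> phibil phic; have [Az _] := @fourier_algebra0 R.
have linl g : fourier_algebra g -> linear_on_algebra (phi^~ g).
  by move=> Ag a f1 f2 A1 A2; exact: phibil.1.
have linr f : fourier_algebra f -> linear_on_algebra (phi f).
  by move=> Af a f1 f2 A1 A2; exact: phibil.2.
have [d d0 hd] := phic _ _ Az Az 1 ltr01.
have sub0 f : f \- (fun=> 0) = f :> (R -> R[i]) by apply/funext => t /=; rewrite subr0.
have small f g : fourier_algebra f -> fourier_algebra g -> fourier_norm f < d ->
    fourier_norm g < d -> normc (phi f g) <= 1.
  move=> Af Ag fd gd; have := hd f g Af Ag.
  rewrite !sub0 => /(_ fd gd).
  by rewrite (linear_on_algebra0 (linl _ Az)) subr0 => /ltW.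
have norm0 f : fourier_algebra f -> fourier_norm f <= 0 -> f = fun=> 0.
  move=> Af n0; apply/funext => t; apply: ComplexField.Normc.eq0_normc; apply/eqP.
  rewrite eq_le normc_ge0 andbT; exact: le_trans (normc_le_fourier_norm t Af) n0.
have scale f : fourier_algebra f -> 0 < fourier_norm f ->
    exists f', [/\ fourier_algebra f', fourier_norm f' < d &
      f = (2 * fourier_norm f / d)%:C \*o f'].
  move=> Af n0; exists ((d / (2 * fourier_norm f))%:C \*o f).
  have [h1 h2] := fourier_algebraZ (d / (2 * fourier_norm f))%:C Af.
  have e0 : 0 < d / (2 * fourier_norm f) by apply: (divr_gt0 d0); apply: mulr_gt0.
  split; first exact: h1.
    apply: (le_lt_trans h2); rewrite normc_real (gtr0_norm e0).
    have -> : d / (2 * fourier_norm f) * fourier_norm f = d / 2 by field; rewrite gt_eqF.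
    lra.
  apply/funext => t /=; rewrite mulrA -rmorphM.
  have -> : 2 * fourier_norm f / d * (d / (2 * fourier_norm f)) = 1.
    by field; rewrite !gt_eqF.
  by rewrite mul1r.
have nf0 f : 0 <= fourier_norm f := fourier_norm_ge0 f.
exists (4 / d ^+ 2); split; first exact: phibil.
  by rewrite divr_ge0 ?sqr_ge0.
move=> f g Af Ag.
have rhs0 : 0 <= 4 / d ^+ 2 * fourier_norm f * fourier_norm g.
  by apply: mulr_ge0 => //; apply: mulr_ge0 => //; rewrite divr_ge0 ?sqr_ge0.
have [f0|f0] := leP (fourier_norm f) 0.
  by rewrite {1}(norm0 f Af f0) (linear_on_algebra0 (linl _ Ag)) ComplexField.Normc.normc0.
have [g0|g0] := leP (fourier_norm g) 0.
  by rewrite {1}(norm0 g Ag g0) (linear_on_algebra0 (linr _ Af)) ComplexField.Normc.normc0.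
have [f' [Af' f'd fE]] := scale f Af f0; have [g' [Ag' g'd gE]] := scale g Ag g0.
rewrite {1}fE (linear_on_algebraZ _ (linl _ Ag) Af').
rewrite {1}gE (linear_on_algebraZ _ (linr _ Af') Ag').
have pos (x : R) : 0 < x -> 0 <= 2 * x / d.
  by move=> x0; apply: (divr_ge0 _ (ltW d0)); apply: mulr_ge0 => //; exact: ltW.
have split4 (x y : R) : 4 / d ^+ 2 * x * y = (2 * x / d) * ((2 * y / d) * 1).
  by field; rewrite gt_eqF.
rewrite !normcZ (ger0_norm (pos _ f0)) (ger0_norm (pos _ g0)) split4.
apply: (ler_wpM2l (pos _ f0)); apply: (ler_wpM2l (pos _ g0)).
exact: small Af' Ag' f'd g'd.
Qed.

(** Pass from characters to all of A(T) one variable at a time: h, then f, then g. *)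
Lemma shift_bound_algebra phi M C f g h : bounded_form phi M ->
  (forall j k l, normc (phi (chr (j + k)) (chr l) - phi (chr j) (chr (l + k))) <= C) ->
  fourier_algebra f -> fourier_algebra g -> fourier_algebra h ->
  normc (phi (f \* g) h - phi f (g \* h)) <=
    C * fourier_norm f * fourier_norm g * fourier_norm h.
Proof.
move=> phiB phiC Af Ag Ah; have [phibil M0 phiM] := phiB.
have AM f1 f2 : fourier_algebra f1 -> fourier_algebra f2 -> fourier_algebra (f1 \* f2).
  by move=> A1 A2; exact: (fourier_algebraM A1 A2).1.
have Ac n : fourier_algebra (chr n : R -> R[i]) := (fourier_algebra_chr n).1.
have nc n : fourier_norm (chr n : R -> R[i]) <= 1 := (fourier_algebra_chr n).2.
have n0 f1 : 0 <= fourier_norm f1 := fourier_norm_ge0 f1.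
have bnd f1 f2 f3 : fourier_algebra f1 -> fourier_algebra f2 -> fourier_algebra f3 ->
    normc (phi (f1 \* f2) f3 - phi f1 (f2 \* f3)) <=
      2 * M * (fourier_norm f1 * fourier_norm f2 * fourier_norm f3).
  move=> A1 A2 A3; apply: (le_trans (normcD _ _)); rewrite normcN.
  have h1 := phiM _ _ (AM _ _ A1 A2) A3; have h2 := phiM _ _ A1 (AM _ _ A2 A3).
  have double (x y z : R) : 2 * M * (x * y * z) = M * (x * y) * z + M * x * (y * z) by ring.
  rewrite double.
  apply: lerD.
    apply: (le_trans h1); apply: (ler_wpM2r (n0 _)); apply: (ler_wpM2l M0).
    exact: (fourier_algebraM A1 A2).2.
  apply: (le_trans h2); apply: ler_wpM2l; first exact: mulr_ge0.
  exact: (fourier_algebraM A2 A3).2.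
have M2 : 0 <= 2 * M by exact: mulr_ge0.
have comb1 a f1 f2 f3 :
    (a \*o f1 \+ f2) \* f3 = a \*o (f1 \* f3) \+ (f2 \* f3) :> (R -> R[i]).
  by apply/funext => t /=; ring.
have comb2 a f1 f2 f3 :
    f3 \* (a \*o f1 \+ f2) = a \*o (f3 \* f1) \+ (f3 \* f2) :> (R -> R[i]).
  by apply/funext => t /=; ring.
have chrE m n : chr m \* chr n = chr (m + n) :> (R -> R[i]).
  by apply/funext => t /=; rewrite chrD.
have step1 m n u : fourier_algebra u ->
    normc (phi (chr m \* chr n) u - phi (chr m) (chr n \* u)) <= C * fourier_norm u.
  move=> Au; apply: (@linear_bound_of_chr R
    (fun u => phi (chr m \* chr n) u - phi (chr m) (chr n \* u)) (2 * M) C _ M2 _ _ u Au).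
  - move=> a f1 f2 A1 A2; have An := AM _ _ (Ac n).
    rewrite comb2 (phibil.2 a _ _ _ (AM _ _ (Ac m) (Ac n)) A1 A2).
    by rewrite (phibil.2 a _ _ _ (Ac m) (An _ A1) (An _ A2)); ring.
  - move=> f1 A1; apply: (le_trans (bnd _ _ _ (Ac m) (Ac n) A1)).
    apply: (ler_wpM2l M2); rewrite -[leRHS]mul1r; apply: (ler_wpM2r (n0 _)).
    by rewrite -[leRHS]mul1r; apply: ler_pM.
  - by move=> p; rewrite !chrE (addrC n p); exact: phiC.
have step2 n v u : fourier_algebra u -> fourier_algebra v ->
    normc (phi (v \* chr n) u - phi v (chr n \* u)) <= C * fourier_norm u * fourier_norm v.
  move=> Au Av; apply: (@linear_bound_of_chr R
    (fun v => phi (v \* chr n) u - phi v (chr n \* u)) (2 * M * fourier_norm u)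
    _ _ _ _ _ v Av).
  - move=> a f1 f2 A1 A2; have An f' A' := AM f' _ A' (Ac n).
    rewrite comb1 (phibil.1 a _ _ _ (An _ A1) (An _ A2) Au).
    by rewrite (phibil.1 a _ _ _ A1 A2 (AM _ _ (Ac n) Au)); ring.
  - exact: mulr_ge0.
  - move=> f1 A1; apply: (le_trans (bnd _ _ _ A1 (Ac n) Au)).
    rewrite -[leRHS]mulrA; apply: (ler_wpM2l M2); rewrite mulrC; apply: (ler_wpM2l (n0 _)).
    by rewrite -[leRHS]mulr1; apply: ler_pM.
  - by move=> p; exact: step1.
have step3 : normc (phi (f \* g) h - phi f (g \* h)) <=
    C * fourier_norm h * fourier_norm f * fourier_norm g.
  apply: (@linear_bound_of_chr R
    (fun g => phi (f \* g) h - phi f (g \* h))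
    (2 * M * (fourier_norm f * fourier_norm h)) _ _ _ _ _ g Ag).
  - move=> a f1 f2 A1 A2; have Ar f' A' := AM f' _ A' Ah; have Al f' A' := AM _ f' Af A'.
    rewrite comb1 comb2 (phibil.1 a _ _ _ (Al _ A1) (Al _ A2) Ah).
    by rewrite (phibil.2 a _ _ _ Af (Ar _ A1) (Ar _ A2)); ring.
  - by apply: mulr_ge0 => //; exact: mulr_ge0.
  - move=> f1 A1; apply: (le_trans (bnd _ _ _ Af A1 Ah)).
    by rewrite -[leRHS]mulrA; apply: (ler_wpM2l M2); rewrite mulrAC.
  - by move=> p; exact: step2.
have rot (x y z : R) : C * z * x * y = C * x * y * z by ring.
by have := step3; rewrite rot => h3; exact: h3.
Qed.

Lemma constant_le : 152 <= 288%:R * pi * (1 + Num.sqrt 2%:R) :> R.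
Proof.
have gen (p s : R) : 2 <= p -> 0 <= s -> 152 <= 288%:R * p * (1 + s) by nra.
exact: gen (pi_ge2 R) (sqrtr_ge0 2%:R).
Qed.

End Extension.

Theorem theorem3p3 (R : realType)
    (phi : (R -> R[i]) -> (R -> R[i]) -> R[i]) (alpha : R)
    (phi_bilinear : bilinear_on_fourier_algebra phi)
    (phi_continuous : continuous_on_fourier_algebra phi)
    (alpha_ge0 : 0 <= alpha)
    (phi_disjoint : forall f g : R -> R[i],
       fourier_algebra f -> fourier_algebra g ->
       supp f `&` supp g = set0 ->
       normc (phi f g) <= alpha * fourier_norm f * fourier_norm g)
    (f g h : R -> R[i])
    (Af : fourier_algebra f) (Ag : fourier_algebra g)
    (Ah : fourier_algebra h) :
  normc (phi (f \* g) h - phi f (g \* h)) <=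
    288%:R * pi * (1 + Num.sqrt 2%:R) * alpha *
      fourier_norm f * fourier_norm g * fourier_norm h.
Proof.
have [M phiB] := bounded_form_of_continuous phi_bilinear phi_continuous.
have phiC j k l := shift_bound_chr j l k phiB phi_disjoint alpha_ge0.
apply: (le_trans (shift_bound_algebra phiB phiC Af Ag Ah)).
have n0 u : 0 <= fourier_norm u := fourier_norm_ge0 u.
do 3 (apply: ler_wpM2r; first exact: n0).
apply: (ler_wpM2r alpha_ge0).
exact: constant_le.
Qed.
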